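(* There is a universal constant $c>0$ such that for every sufficiently large $n$ there exists a convex body $K\subset\mathbb{R}^n$ in John's position such that there is no polytope $P\subset\mathbb{R}^n$ that has less than $\exp(cn)$ facets and satisfies $$K\subset P\subset\sqrt{n}\,K.$$
   Context: A convex body in $\mathbb{R}^n$ is a compact convex set with non-empty interior. The John ellipsoid of a convex body is the unique ellipsoid of maximal volume contained in it. A convex body is in John's position if its John ellipsoid is the Euclidean unit ball $B_2^n$ centered at the origin. A polytope is a compact convex polytope, and its number of facets is the number of its $(n-1)$-dimensional faces. For $R>0$, $RK=\{Rx : x\in K\}$. *)

(* Defs.v *)
From HB Require Import structures.
From mathcomp Require Import all_boot all_order all_algebra.
From mathcomp Require Import all_classical all_reals all_analysis.
Set Implicit Arguments.
Unset Strict Implicit.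
Unset Printing Implicit Defensive.
Import Order.TTheory GRing.Theory Num.Theory.
Import numFieldNormedType.Exports.
Local Open Scope classical_set_scope.
Local Open Scope ring_scope.

Section Definitions.
Context {R : realType} {n : nat}.
Local Notation V := 'rV[R]_n.
Implicit Types (A E F K P : set V) (x u : V).

Definition dot u x : R := \sum_(i < n) u 0 i * x 0 i.

(* The library's norm on matrices is the sup norm. *)
Definition enorm x : R := Num.sqrt (dot x x).

Definition unit_ball : set V := [set x | enorm x <= 1].

Definition convex_body K : Prop :=
  [/\ @convex_set R V K, compact K & K° !=set0].

Definition box (a b : V) : set V :=
  [set x | forall i, a 0 i <= x 0 i <= b 0 i].

(* n-dimensional Lebesgue outer measure, by countable covers with boxes; it is
   the volume on all Lebesgue measurable sets, in particular on ellipsoids.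
   Meaningful for n > 0 only. *)
Definition volume A : \bar R :=
  ereal_inf [set v | exists a b : nat -> V,
    [/\ forall k i, a k 0 i <= b k 0 i,
        A `<=` \bigcup_k box (a k) (b k)
      & v = (\sum_(0 <= k <oo) (\prod_(i < n) (b k 0 i - a k 0 i))%:E)%E]].

Definition ellipsoid E : Prop :=
  exists M : 'M[R]_n, exists c : V,
    M \in unitmx /\ E = [set x *m M + c | x in unit_ball].

Definition max_volume_ellipsoid K E : Prop :=
  [/\ ellipsoid E, E `<=` K
    & forall E', ellipsoid E' -> E' `<=` K -> (volume E' <= volume E)%E].

Definition john_ellipsoid K E : Prop :=
  max_volume_ellipsoid K E /\
  forall E', max_volume_ellipsoid K E' -> E' = E.

Definition john_position K : Prop := john_ellipsoid K unit_ball.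

Definition halfspace u (b : R) : set V := [set x | dot u x <= b].

Definition hyperplane u (b : R) : set V := [set x | dot u x = b].

Definition polytope P : Prop :=
  compact P /\
  exists m : nat, exists u : 'I_m -> V, exists b : 'I_m -> R,
    (forall j, u j != 0) /\ P = \bigcap_(j in [set: 'I_m]) halfspace (u j) (b j).

(* u = 0 is allowed, so P and the empty set count as (improper) faces. *)
Definition face P F : Prop :=
  exists u, exists b : R,
    P `<=` halfspace u b /\ F = P `&` hyperplane u b.

Definition flat (d : nat) A : Prop :=
  exists x0 : V, exists2 U : {vspace V},
    \dim U = d & A = [set x0 + u | u in [set` U]].

Definition affine_hull A : set V :=
  smallest [set B | exists d, flat d B] A.

Definition has_dim A (d : nat) : Prop := flat d (affine_hull A).

Definition facets P : set (set V) :=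
  [set F | face P F /\ has_dim F n.-1].

Definition dilate (r : R) K : set V := [set r *: x | x in K].

End Definitions.

(* Main.v *)
Require Import Defs.
From mathcomp Require Import all_boot all_order all_algebra.
From mathcomp Require Import all_classical all_reals all_analysis.
From mathcomp Require Import measurable_realfun.
From mathcomp Require Import ring lra zify.
Set Implicit Arguments.
Unset Strict Implicit.
Unset Printing Implicit Defensive.
Import Order.TTheory GRing.Theory Num.Theory.
Import numFieldNormedType.Exports.
Local Open Scope classical_set_scope.
Local Open Scope card_scope.
Local Open Scope ring_scope.

(** Let [u_0, .., u_n] be the unit outer normals of a regular simplex
circumscribed about the Euclidean ball.  They sum to zero and a multiple of
[\sum_i u_i u_i^T] is the identity, so by John's criterion every convex body
between the ball and the simplex is in John's position.  The body [K] is the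
simplex cut by exponentially many further half-spaces [<v_J, x> <= 1] with
[|v_J| <= 1], one for each member [J] of a family of sets of about [n / 128]
coordinates that pairwise share at most half of their elements.

What makes [K] hard to approximate is that the simplex extends far in the
direction of [- \sum_(l in J) u_l] when [J] is a small set: there are points
[y_J], close to this direction, with
- [<u_i, y_J> <= 1 / sqrt n] for all [i],
- [1 < <v_J, y_J> <= 2], so that [y_J] is outside [K], and
- [<v_J, y_J'> <= 0] for [J <> J'].
If [K <= P <= sqrt n K], then [sqrt n y_J] is outside [P], so a facet of [P]
separates it from [P]; say its half-space is [<a, x> <= 1].  If the same
facet separated [N > 2 sqrt n] of these points, then the point
[(sqrt n / N) \sum_J y_J], the sum being over those [J], would satisfy all
the constraints that define [K], whereas its product with [a] exceeds [1].
Thus every facet deals with at most [2 sqrt n] of exponentially many points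
([hidden_points_bound], [facets_lower_bound]).

Three classical facts are proved on the way.
- John's criterion ([john_position_of_contacts]): by the QR decomposition an
  ellipsoid is, up to translation, the image of the ball under a triangular
  matrix [T] with positive diagonal.  Being inscribed forces [\tr T <= n],
  and the arithmetic-geometric mean inequality bounds the product of the
  diagonal, which is the factor by which [T] scales the volume.
- The volume bounds this needs: [volume_triangular] reduces triangular
  matrices to shears, which are handled by slicing boxes, and
  [volume_unit_ball_gt0] integrates the multiplicity of a cover.
- A polytope around the origin is the intersection of the half-spaces of its
  facets ([facet_description]), so that only facets have to be counted.
The family of sets comes from a code over an alphabet of [128] letters, whose
words are turned into their graphs ([subsets_with_small_overlaps]). *)

(** * Inner products and Euclidean norm *)

Section Dot.
Context {R : realType} {n : nat}.
Implicit Types (x y u v : 'rV[R]_n).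

Lemma dotC u x : dot u x = dot x u.
Proof. by apply: eq_bigr => i _; rewrite mulrC. Qed.

Lemma dotDr u x y : dot u (x + y) = dot u x + dot u y.
Proof. by rewrite -big_split; apply: eq_bigr => i _; rewrite mxE mulrDr. Qed.

Lemma dotZr u (a : R) x : dot u (a *: x) = a * dot u x.
Proof. by rewrite mulr_sumr; apply: eq_bigr => i _; rewrite mxE mulrCA. Qed.

Lemma dotNr u x : dot u (- x) = - dot u x.
Proof. by rewrite -scaleN1r dotZr mulN1r. Qed.

Lemma dotBr u x y : dot u (x - y) = dot u x - dot u y.
Proof. by rewrite dotDr dotNr. Qed.

Lemma dotDl u v x : dot (u + v) x = dot u x + dot v x.
Proof. by rewrite dotC dotDr !(dotC x). Qed.

Lemma dotZl (a : R) u x : dot (a *: u) x = a * dot u x.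
Proof. by rewrite dotC dotZr dotC. Qed.

Lemma dotBl u v x : dot (u - v) x = dot u x - dot v x.
Proof. by rewrite !(dotC _ x) dotBr. Qed.

Lemma dot0r u : dot u 0 = 0.
Proof. by rewrite -(scale0r 0) dotZr mul0r. Qed.

Lemma dot_sumr (I : Type) (s : seq I) (P : pred I) (F : I -> 'rV[R]_n) u :
  dot u (\sum_(i <- s | P i) F i) = \sum_(i <- s | P i) dot u (F i).
Proof. by apply: (big_morph (dot u) (dotDr u)); rewrite dot0r. Qed.

Lemma dot_suml (I : Type) (s : seq I) (P : pred I) (F : I -> 'rV[R]_n) u :
  dot (\sum_(i <- s | P i) F i) u = \sum_(i <- s | P i) dot (F i) u.
Proof. by rewrite dotC dot_sumr; apply: eq_bigr => i _; rewrite dotC. Qed.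

Lemma dot_delta l x : dot (delta_mx 0 l) x = x 0 l.
Proof.
rewrite /dot (bigD1 l) //= big1 ?mxE ?eqxx ?mul1r ?addr0 // => k kl.
by rewrite mxE (negPf kl) andbF mul0r.
Qed.

Lemma dot_ge0 x : 0 <= dot x x.
Proof. by apply: sumr_ge0 => i _; rewrite -expr2 sqr_ge0. Qed.

Lemma dot_eq0 x : (dot x x == 0) = (x == 0).
Proof.
apply/eqP/eqP => [|->]; last exact: dot0r.
move=> /(psumr_eq0P (fun i _ => sqr_ge0 _)) h.
by apply/rowP => i; apply/eqP; rewrite mxE -sqrf_eq0 (h i).
Qed.

Lemma enorm_ge0 x : 0 <= enorm x.
Proof. exact: sqrtr_ge0. Qed.

Lemma enorm0 : enorm (0 : 'rV[R]_n) = 0.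
Proof. by rewrite /enorm dot0r sqrtr0. Qed.

Lemma enorm_sqr x : enorm x ^+ 2 = dot x x.
Proof. by rewrite sqr_sqrtr // dot_ge0. Qed.

Lemma unit_ballE x : unit_ball x <-> dot x x <= 1.
Proof.
by rewrite /unit_ball /= -enorm_sqr -{2}(expr1n R 2) ler_sqr ?nnegrE ?enorm_ge0.
Qed.

Lemma unit_ball_of_coords x : (forall i, `|x 0 i| <= n%:R^-1) -> unit_ball x.
Proof.
move=> xn; have [n0|n0] := posnP n.
  by rewrite unit_ballE /dot big1 ?ler01 // => i; exfalso; have := ltn_ord i; lia.
have nR : 0 < n%:R :> R by rewrite ltr0n.
rewrite unit_ballE; apply: (@le_trans _ _ (\sum_(i < n) n%:R^-1)); last first.
  by rewrite sumr_const card_ord -[leLHS]mulr_natl mulfV // gt_eqF.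
apply: ler_sum => i _; rewrite -expr2 -real_normK ?num_real //.
apply: (@le_trans _ _ (n%:R^-1 ^+ 2)).
  by rewrite ler_pXn2r ?nnegrE ?invr_ge0 // ltW.
by rewrite expr2 ger_pMr ?invr_gt0 // invf_le1 // ler1n.
Qed.

Lemma cauchy_schwarz u x : dot u x ^+ 2 <= dot u u * dot x x.
Proof.
have [/eqP|x0] := eqVneq x 0.
  by move/eqP ->; rewrite !dot0r mulr0 expr2 mul0r.
have xx : 0 < dot x x by rewrite lt_def dot_eq0 x0 dot_ge0.
have := dot_ge0 (dot x x *: u - dot u x *: x).
rewrite dotBr !dotBl !dotZl !dotZr (dotC x u).
set a := dot u u; set b := dot u x; set c := dot x x.
rewrite (_ : _ - _ = c * (a * c - b ^+ 2)); last by ring.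
by rewrite pmulr_rge0 // subr_ge0.
Qed.

Lemma dot_le_enorm u x : dot u x <= enorm u * enorm x.
Proof.
apply: le_trans (ler_norm _) _.
rewrite -ler_sqr ?nnegrE ?mulr_ge0 ?enorm_ge0 // real_normK ?num_real //.
by rewrite exprMn !enorm_sqr cauchy_schwarz.
Qed.

Lemma dot_unit_le_enorm u x : dot u u = 1 -> dot u x <= enorm x.
Proof.
by move=> u1; apply: le_trans (dot_le_enorm u x) _; rewrite {1}/enorm u1 sqrtr1 mul1r.
Qed.

Lemma cauchy_schwarz_eq u x : dot u u = 1 -> dot u x = enorm x ->
  x = dot u x *: u.
Proof.
move=> u1 ux; apply/eqP; rewrite -subr_eq0 -dot_eq0.
rewrite dotBr !dotBl !dotZl !dotZr (dotC x u) u1 -enorm_sqr -ux.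
by apply/eqP; ring.
Qed.

Lemma coord_le_enorm x i : `|x 0 i| <= enorm x.
Proof.
rewrite -ler_sqr ?nnegrE ?enorm_ge0 // real_normK ?num_real // enorm_sqr.
rewrite /dot (bigD1 i) //= -expr2 lerDl.
by apply: sumr_ge0 => j _; rewrite -expr2 sqr_ge0.
Qed.

Lemma ball_support (w : 'rV[R]_n) : exists2 x : 'rV[R]_n, unit_ball x & dot x w = enorm w.
Proof.
have [->|w0] := eqVneq w 0.
  by exists 0; [rewrite unit_ballE dot0r ler01|rewrite dot0r enorm0].
have ww : 0 < enorm w by rewrite sqrtr_gt0 lt_def dot_eq0 w0 dot_ge0.
exists ((enorm w)^-1 *: w).
  by rewrite unit_ballE dotZl dotZr -enorm_sqr expr2 mulKf ?mulVf ?gt_eqF.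
by rewrite dotZl -enorm_sqr expr2 mulKf ?gt_eqF.
Qed.

End Dot.

Lemma dotE (R : realType) (n : nat) (u x : 'rV[R]_n) : dot u x = (u *m x^T) 0 0.
Proof. by rewrite mxE; apply: eq_bigr => i _; rewrite mxE. Qed.

Lemma dot_mulmx (R : realType) (m n : nat) (x : 'rV[R]_m) (M : 'M[R]_(m, n)) u :
  dot (x *m M) u = dot x (u *m M^T).
Proof. by rewrite !dotE trmx_mul trmxK mulmxA. Qed.

(** * Volume: subadditivity and affine changes of coordinates *)

Section Volume.
Context {R : realType} {n : nat}.
Implicit Types (a b c x : 'rV[R]_n).

Definition box_volume a b : R := \prod_(i < n) (b 0 i - a 0 i).

Lemma box_volume_ge0 a b : (forall i, a 0 i <= b 0 i) -> 0 <= box_volume a b.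
Proof. by move=> ab; apply: prodr_ge0 => i _; rewrite subr_ge0. Qed.

Lemma volume_le_cover (A : set 'rV[R]_n) (a b : nat -> 'rV[R]_n) :
  (forall k i, a k 0 i <= b k 0 i) ->
  A `<=` \bigcup_k box (a k) (b k) ->
  (volume A <= \sum_(0 <= k <oo) (box_volume (a k) (b k))%:E)%E.
Proof. by move=> ab cov; apply: ereal_inf_lbound; exists a, b. Qed.

Lemma volume_ge0 (A : set 'rV[R]_n) : (0 <= volume A)%E.
Proof.
apply: le_ereal_inf_tmp => _ [a [b [ab _ ->]]].
by apply: nneseries_ge0 => k _ _; rewrite lee_fin box_volume_ge0.
Qed.

Lemma volume_mono (A B : set 'rV[R]_n) : A `<=` B -> (volume A <= volume B)%E.
Proof.
move=> AB; apply: ereal_inf_le_tmp => _ [a [b [ab cov ->]]].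
by exists a, b; split => //; apply: subset_trans cov.
Qed.

(** A doubly indexed cover is enumerated by a bijection with [nat]. *)
Lemma volume_le_cover2 (A : set 'rV[R]_n) (a b : nat * nat -> 'rV[R]_n) :
  (forall k i, a k 0 i <= b k 0 i) ->
  A `<=` \bigcup_k box (a k) (b k) ->
  (volume A <= \esum_(k in [set: nat * nat]) (box_volume (a k) (b k))%:E)%E.
Proof.
move=> ab cov; have /card_esym/card_set_bijP[f fbij] := card_nat2.
rewrite (reindex_esum _ _ _ _ fbij) -nneseries_esumT; last first.
  by move=> k; rewrite lee_fin box_volume_ge0.
apply: volume_le_cover => // x /cov [k _ kx].
by case: fbij => _ _ /(_ k I)[j _ jk]; exists j => //; rewrite jk.
Qed.

(** Countable subadditivity.  The bounds [v k] are real numbers, so each [S k]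
has a cover exceeding [v k] by at most [e / 2 ^ k.+1], and these covers
together exceed the sum of the [v k] by at most [e]. *)
Lemma volume_sub_bigcup (A : set 'rV[R]_n) (S : nat -> set 'rV[R]_n)
    (v : nat -> R) :
  (forall k, 0 <= v k) -> (forall k, (volume (S k) <= (v k)%:E)%E) ->
  A `<=` \bigcup_k S k ->
  (volume A <= \sum_(0 <= k <oo) (v k)%:E)%E.
Proof.
move=> v0 vS cov; apply/lee_addgt0Pr => e e0.
have vE0 k : (0 <= (v k)%:E)%E by rewrite lee_fin.
apply: le_trans (epsilon_trick xpredT vE0 (ltW e0)).
pose P k (g : (nat -> 'rV[R]_n) * (nat -> 'rV[R]_n)) :=
  [/\ forall j i, g.1 j 0 i <= g.2 j 0 i,
      S k `<=` \bigcup_j box (g.1 j) (g.2 j) &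
      (\sum_(0 <= j <oo) (box_volume (g.1 j) (g.2 j))%:E <=
        (v k)%:E + (e / (2 ^ k.+1)%:R)%:E)%E].
have [G PG] : {G & forall k, P k (G k)}.
  apply: (@choice _ _ P) => k.
  have : (volume (S k) < (v k)%:E + (e / (2 ^ k.+1)%:R)%:E)%E.
    apply: le_lt_trans (vS k) _.
    by rewrite lteDl // lte_fin divr_gt0 // ltr0n expn_gt0.
  by move=> /ereal_inf_lt[_ [a [b [ab cab ->]]] /ltW ltv]; exists (a, b).
pose a k := (G k.1).1 k.2; pose b k := (G k.1).2 k.2.
have ab k i : a k 0 i <= b k 0 i by case: (PG k.1) => + _ _; apply.
apply: (@le_trans _ _ (\esum_(k in [set: nat * nat]) (box_volume (a k) (b k))%:E)%E).
  apply: volume_le_cover2 => // x /cov[k _ kx].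
  by case: (PG k) => _ /(_ x kx)[j _ jx] _; exists (k, j).
have -> : [set: nat * nat] = [set: nat] `*`` (fun=> [set: nat]).
  by apply/seteqP; split.
rewrite -(@esum_esum _ _ _ _ _ (fun k j => (box_volume (a (k, j)) (b (k, j)))%:E)); last first.
  by move=> k j _ _; rewrite lee_fin box_volume_ge0.
rewrite nneseries_esumT; last first.
  by move=> k; rewrite adde_ge0 // lee_fin divr_ge0 // ltW.
apply: le_esum => k _; rewrite -nneseries_esumT; first by case: (PG k).
by move=> j; rewrite lee_fin (box_volume_ge0 (ab (k, j))).
Qed.

End Volume.

Section VolumeTransport.
Context {R : realType} {n : nat}.
Implicit Types (a b c x : 'rV[R]_n).

(** It is enough to control images of boxes, because every cover of [A] by
boxes is mapped to a cover of the image by images of boxes. *)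
Lemma volume_image_le (f : 'rV[R]_n -> 'rV[R]_n) (d : R) (A : set 'rV[R]_n) :
  0 < d ->
  (forall a b, (forall i, a 0 i <= b 0 i) ->
    (volume (f @` box a b) <= (d * box_volume a b)%:E)%E) ->
  (volume (f @` A) <= d%:E * volume A)%E.
Proof.
move=> d0 fbox; rewrite -lee_pdivrMl //.
apply: le_ereal_inf_tmp => _ [a [b [ab cov ->]]].
rewrite lee_pdivrMl // -nneseriesZl; last first.
  by move=> k _; rewrite lee_fin (box_volume_ge0 (ab k)).
apply: (@volume_sub_bigcup _ _ _ (fun k => f @` box (a k) (b k))
  (fun k => d * box_volume (a k) (b k))).
- by move=> k; rewrite mulr_ge0 ?box_volume_ge0 // ltW.
- by move=> k; exact: fbox.
- by move=> _ [x /cov[k _ kx] <-]; exists k => //; exists x.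
Qed.

(** A box with equal corners has volume zero, which needs a coordinate. *)
Lemma volume0 : (0 < n)%N -> (volume (set0 : set 'rV[R]_n) <= 0)%E.
Proof.
move=> n0; apply: le_trans (@volume_le_cover _ _ _ (fun=> 0) (fun=> 0) _ _) _ => //.
rewrite eseries0 // => k _ _.
by rewrite /box_volume (bigD1 (Ordinal n0)) //= subrr mul0r.
Qed.

Lemma volume_sub_finite (A : set 'rV[R]_n) (N : nat) (S : nat -> set 'rV[R]_n)
    (v : nat -> R) : (0 < n)%N ->
  (forall k, 0 <= v k) -> (forall k, (volume (S k) <= (v k)%:E)%E) ->
  (forall x, A x -> exists2 k, (k < N)%N & S k x) ->
  (volume A <= (\sum_(k < N) v k)%:E)%E.
Proof.
move=> n0 v0 vS cov.
apply: (@le_trans _ _ (\sum_(0 <= k <oo) (if (k < N)%N then v k else 0)%:E)%E).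
  apply: (@volume_sub_bigcup _ _ _ (fun k => if (k < N)%N then S k else set0)).
  - by move=> k; case: ifP.
  - by move=> k; case: ifP => // _; exact: volume0.
  - by move=> x /cov[k kN Sx]; exists k => //; rewrite kN.
rewrite (nneseries_split 0 N); last by move=> k _; case: ifP; rewrite lee_fin.
rewrite add0n eseries0; last by move=> k Nk _; rewrite ltnNge Nk.
rewrite adde0 sumEFin lee_fin big_mkord; apply: ler_sum => k _.
by rewrite ltn_ord.
Qed.

Lemma volume_box_le a b : (0 < n)%N -> (forall i, a 0 i <= b 0 i) ->
  (volume (box a b) <= (box_volume a b)%:E)%E.
Proof.
move=> n0 ab.
apply: le_trans (@volume_le_cover _ _ _
  (fun k => if k is 0%N then a else 0) (fun k => if k is 0%N then b else 0) _ _) _.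
- by case.
- by move=> x abx; exists 0%N.
rewrite (nneseries_split 0 1); last first.
  by move=> [|k] _; rewrite lee_fin box_volume_ge0.
rewrite add0n eseries0 ?big_nat1 ?adde0 // => -[|k] // _ _.
by rewrite /box_volume (bigD1 (Ordinal n0)) //= subrr mul0r.
Qed.

Lemma volume_translate c (A : set 'rV[R]_n) : (0 < n)%N ->
  (volume [set (x + c)%R | x in A] <= volume A)%E.
Proof.
move=> n0; rewrite -[leRHS]mul1e; apply: volume_image_le => // a b ab.
apply: (@le_trans _ _ (volume (box (a + c)%R (b + c)%R))).
  by apply: volume_mono => _ [x abx <-] i; rewrite !mxE !lerD2r.
apply: le_trans (volume_box_le n0 _) _ => [i|]; first by rewrite !mxE lerD2r ab.
rewrite mul1r lee_fin le_eqVlt; apply/orP; left; apply/eqP.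
by apply: eq_bigr => i _; rewrite !mxE; ring.
Qed.

Definition coord_upd (r : 'I_n) (g : 'rV[R]_n -> R) x : 'rV[R]_n :=
  \row_i if i == r then g x else x 0 i.

Lemma volume_scale_coord (r : 'I_n) (t : R) (A : set 'rV[R]_n) : 0 < t ->
  (volume (coord_upd r (fun x => t * x 0 r)%R @` A) <= t%:E * volume A)%E.
Proof.
move=> t0; have n0 : (0 < n)%N by apply: leq_ltn_trans (ltn_ord r).
apply: volume_image_le => // a b ab.
pose f := coord_upd r (fun x => t * x 0 r).
apply: (@le_trans _ _ (volume (box (f a) (f b)))).
  apply: volume_mono => _ [x abx <-] i; rewrite !mxE.
  by case: eqP => // _; rewrite !ler_pM2l.
apply: le_trans (volume_box_le n0 _) _ => [i|].
  by rewrite !mxE; case: eqP => // _; rewrite ler_pM2l.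
rewrite lee_fin le_eqVlt; apply/orP; left; apply/eqP.
rewrite /box_volume (bigD1 r) //= (bigD1 r (F := fun i => b 0 i - a 0 i)) //=.
rewrite !mxE eqxx -mulrBr -mulrA; congr (_ * (_ * _)).
by apply: eq_bigr => i /negPf ir; rewrite !mxE ir.
Qed.

Lemma slice_exists (N : nat) (h y : R) : 0 <= y -> y <= N.+1%:R * h ->
  exists2 k, (k < N.+1)%N & k%:R * h <= y <= k.+1%:R * h.
Proof.
elim: N => [|N IH] y0 yh; first by exists 0%N; rewrite ?mul0r ?y0.
have [yN|Ny] := leP y (N.+1%:R * h).
  by have [k kN ky] := IH y0 yN; exists k => //; exact: ltnW.
by exists N.+1 => //; rewrite (ltW Ny).
Qed.

(** The image of a thin slab under a shear fits into a box that is only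
slightly larger; cutting a box into many slabs shows that shears do not
increase the volume. *)
Lemma volume_shear (r i : 'I_n) (t : R) (A : set 'rV[R]_n) : i != r ->
  (volume (coord_upd r (fun x => x 0 r + t * x 0 i)%R @` A) <= volume A)%E.
Proof.
move=> ir; have n0 : (0 < n)%N by apply: leq_ltn_trans (ltn_ord r).
rewrite -[leRHS]mul1e; apply: volume_image_le => // a b ab; rewrite mul1r.
pose P := \prod_(j < n | (j != r) && (j != i)) (b 0 j - a 0 j).
have P0 : 0 <= P by apply: prodr_ge0 => j _; rewrite subr_ge0.
pose Li := b 0 i - a 0 i; pose Lr := b 0 r - a 0 r.
have Li0 : 0 <= Li by rewrite subr_ge0.
have Lr0 : 0 <= Lr by rewrite subr_ge0.
have bvE u v : box_volume u v = (v 0 r - u 0 r) * ((v 0 i - u 0 i) *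
    \prod_(j < n | (j != r) && (j != i)) (v 0 j - u 0 j)) :> R.
  by rewrite /box_volume (bigD1 r) //= (bigD1 i).
apply/lee_addgt0Pr => e e0.
(* The boxes around the [N.+1] slabs have total volume exactly
   [C / N.+1] more than the box that is sheared. *)
pose C := 2 * `|t| * Li ^+ 2 * P.
have C0 : 0 <= C by rewrite !mulr_ge0 ?sqr_ge0.
pose N := Num.bound (C / e).
have NC : C / N.+1%:R <= e.
  rewrite ler_pdivrMr ?ltr0n // mulrC -ler_pdivrMr //.
  have := archi_boundP (divr_ge0 C0 (ltW e0)); rewrite -/N => /ltW h.
  by apply: le_trans h _; rewrite ler_nat.
pose h := Li / N.+1%:R.
have h0 : 0 <= h by rewrite divr_ge0.
have Nh : N.+1%:R * h = Li by rewrite mulrC divfK // pnatr_eq0.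
pose p k := a 0 i + k%:R * h.
pose u k : 'rV[R]_n := \row_j if j == r then a 0 r + t * p k - `|t| * h
  else if j == i then p k else a 0 j.
pose v k : 'rV[R]_n := \row_j if j == r then b 0 r + t * p k + `|t| * h
  else if j == i then p k.+1 else b 0 j.
have pS k : p k.+1 = p k + h by rewrite /p -natr1 mulrDl mul1r addrA.
have th0 : 0 <= `|t| * h by rewrite mulr_ge0.
have uv k j : u k 0 j <= v k 0 j.
  rewrite !mxE; case: eqP => [_|_]; first by have := ab r; lra.
  by case: eqP => // _; rewrite pS; lra.
have bvk k : box_volume (u k) (v k) = (Lr + 2 * (`|t| * h)) * (h * P).
  rewrite bvE !mxE !eqxx (negPf ir) pS; congr (_ * (_ * _)); rewrite /Lr; try ring.
  by apply: eq_bigr => j /andP[/negPf jr /negPf ji]; rewrite !mxE jr ji.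
apply: le_trans (@volume_sub_finite _ N.+1 (fun k => box (u k) (v k))
  (fun k => box_volume (u k) (v k)) n0 _ _ _) _.
- by move=> k; exact: box_volume_ge0.
- by move=> k; exact: volume_box_le.
- move=> _ [x abx <-].
  have [||k kN /andP[k1 k2]] := @slice_exists N h (x 0 i - a 0 i).
  + by rewrite subr_ge0; case/andP: (abx i).
  + by rewrite Nh lerB //; case/andP: (abx i).
  exists k => // j; rewrite !mxE.
  have xi1 : 0 <= x 0 i - p k by rewrite /p; lra.
  have xi2 : x 0 i - p k <= h by move: k2; rewrite /p -natr1; lra.
  have [_|_] := eqVneq j r.
    have := abx r => /andP[r1 r2].
    have : `|t * (x 0 i - p k)| <= `|t| * h.
      by rewrite normrM ler_wpM2l // ger0_norm.
    by rewrite ler_norml => /andP[t1 t2]; apply/andP; split; lra.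
  have [->|_] := eqVneq j i; last exact: abx.
  by rewrite pS; apply/andP; split; lra.
rewrite lee_fin; under eq_bigr do rewrite bvk.
rewrite sumr_const card_ord bvE -/Lr -/Li -/P -[leLHS]mulr_natl.
have -> : N.+1%:R * ((Lr + 2 * (`|t| * h)) * (h * P)) =
    (N.+1%:R * h) * ((Lr + 2 * (`|t| * h)) * P) by ring.
rewrite Nh.
have -> : Li * ((Lr + 2 * (`|t| * h)) * P) = Lr * (Li * P) + C / N.+1%:R.
  by rewrite /C /h; ring.
by rewrite lerD2l.
Qed.

End VolumeTransport.

(** * Volume of the ball: positive and finite *)

Section CoverBound.
Context {R : realType}.

Lemma indicM_itv (a b y : R) : \1_(`[a, b]%classic : set R) y = (a <= y <= b)%R%:R :> R.
Proof. by rewrite indicE mem_setE in_itv. Qed.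

(** The covering multiplicity is at least [1] on the cube, and it is integrated
over one coordinate at a time, so that only the Lebesgue measure of the line
is needed.  The weights carry the induction: fixing the last coordinate
multiplies the weight of every box by [0] or [1]. *)
Lemma weighted_cover_bound (s : R) (A B : nat -> nat -> R) : 0 <= s ->
  (forall k i, A k i <= B k i) ->
  forall (d : nat) (w : nat -> R), (forall k, 0 <= w k) ->
  (forall x : nat -> R, (forall i, - s <= x i <= s) ->
    (1 <= \sum_(0 <= k <oo)
       (w k * \prod_(i < d) (A k i <= x i <= B k i)%R%:R)%:E)%E) ->
  (((2 * s) ^+ d)%:E <=
    \sum_(0 <= k <oo) (w k * \prod_(i < d) (B k i - A k i))%:E)%E.
Proof.
move=> s0 AB; elim=> [|d IH] w w0 cov.
  rewrite expr0; have := cov (fun=> 0).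
  rewrite oppr_le0 s0 => /(_ (fun=> isT)).
  by under eq_eseriesr do rewrite big_ord0;
    under [in X in _ -> X]eq_eseriesr do rewrite big_ord0.
pose P k := w k * \prod_(i < d) (B k i - A k i).
have P0 k : 0 <= P k.
  by rewrite mulr_ge0 // prodr_ge0 // => i _; rewrite subr_ge0.
pose f k (y : R) : \bar R := ((P k)%:E * (\1_(`[A k d, B k d]%classic : set R) y)%:E)%E.
pose g (y : R) : \bar R := (((2 * s) ^+ d)%:E * (\1_(`[- s, s]%classic : set R) y)%:E)%E.
have sd0 : 0 <= (2 * s) ^+ d by rewrite exprn_ge0 // mulr_ge0.
have f0 k y : (0 <= f k y)%E by rewrite mule_ge0 // lee_fin.
have mind (a b : R) : measurable_fun setT (EFin \o (\1_(`[a, b]%classic : set R) : R -> R)).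
  by apply/measurable_EFinP; exact: measurable_indic.
have mf k : measurable_fun setT (f k) by apply: measurable_funeM; exact: mind.
have gf y : (g y <= \sum_(0 <= k <oo) f k y)%E.
  rewrite /g indicM_itv; case: (boolP (- s <= y <= s)) => [ys|_]; last first.
    by rewrite mule0 nneseries_ge0.
  rewrite mule1.
  pose w' k := w k * (A k d <= y <= B k d)%R%:R.
  have w'0 k : 0 <= w' k by rewrite mulr_ge0.
  apply: le_trans (IH w' w'0 _) _ => [x xs|].
    have := cov (fun i => if i == d then y else x i).
    have h i : - s <= (if i == d then y else x i) <= s by case: ifP.
    move=> /(_ h) /le_trans; apply; apply: lee_nneseries => k _.
      by rewrite lee_fin mulr_ge0 // prodr_ge0.
    rewrite lee_fin /w' big_ord_recr /= eqxx -mulrA [X in _ <= _ * X]mulrC.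
    rewrite le_eqVlt; apply/orP; left; apply/eqP; congr (_ * (_ * _)).
    by apply: eq_bigr => i _; rewrite (ltn_eqF (ltn_ord i)).
  apply: lee_nneseries => k _.
    by rewrite lee_fin mulr_ge0 // prodr_ge0 // => i _; rewrite subr_ge0.
  by rewrite /f -EFinM lee_fin indicM_itv /w' /P mulrAC.
have mu_itv (a b : R) : a <= b ->
    (\int[lebesgue_measure]_y (\1_(`[a, b]%classic : set R) y)%:E = (b - a)%:E)%E.
  move=> ab; rewrite integral_indic // setIT/= lebesgue_measure_itv/= lte_fin.
  by case: ltgtP ab => //= ->; rewrite subrr.
have : (\int[lebesgue_measure]_y g y <=
    \int[lebesgue_measure]_y (\sum_(0 <= k <oo) f k y))%E.
  apply: ge0_le_integral => //.
  - by move=> y _; rewrite mule_ge0 // lee_fin.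
  - by apply: measurable_funeM; exact: mind.
  - by apply: (@ge0_emeasurable_sum _ _ _ _ f xpredT).
rewrite integral_nneseries //.
rewrite ge0_integralZl_EFin //; [|exact: mind].
rewrite mu_itv; last by rewrite -subr_ge0 opprK addr_ge0.
rewrite -EFinM opprK -mulr2n -[X in (_ * X)%:E]mulr_natl -exprSr => /le_trans; apply.
apply: lee_nneseries => [k _ _|k _].
  apply: integral_ge0 => y _; exact: f0.
rewrite /f ge0_integralZl_EFin //; [|exact: mind].
by rewrite mu_itv // -EFinM lee_fin /P big_ord_recr /= mulrA.
Qed.

End CoverBound.

Section BallVolume.
Context {R : realType} {n : nat}.

Lemma volume_unit_ball_gt0 : (0 < n)%N ->
  (0 < volume (unit_ball : set 'rV[R]_n))%E.
Proof.
move=> n0; have nR : 0 < n%:R :> R by rewrite ltr0n.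
pose s : R := n%:R^-1.
have s0 : 0 < s by rewrite invr_gt0.
apply: (@lt_le_trans _ _ ((2 * s) ^+ n)%:E).
  by rewrite lte_fin exprn_gt0 // mulr_gt0.
apply: le_ereal_inf_tmp => _ [a [b [ab cov ->]]].
pose A k i := if insub i is Some j then a k 0 j else 0 : R.
pose B k i := if insub i is Some j then b k 0 j else 0 : R.
have AB k i : A k i <= B k i by rewrite /A /B; case: insub.
have := @weighted_cover_bound _ s A B (ltW s0) AB n (fun=> 1) (fun=> ler01).
rewrite (@eq_eseriesr _ _ (fun k => (\prod_(i < n) (b k 0 i - a k 0 i))%:E)); last first.
  move=> k _; rewrite mul1r; congr _%:E; apply: eq_bigr => i _.
  by rewrite /A /B valK.
apply => x xs.
(* A single box that contains [x] already brings the multiplicity to [1]. *)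
have /cov[k _ kx] : unit_ball (\row_(i < n) x i : 'rV[R]_n).
  by apply: unit_ball_of_coords => i; rewrite mxE ler_norml xs.
have term0 j : (0 <= (1 * \prod_(i < n) (A j i <= x i <= B j i)%R%:R)%:E :> \bar R)%E.
  by rewrite mul1r lee_fin prodr_ge0.
apply: le_trans (nneseries_lim_ge k.+1 (fun j _ _ => term0 j)).
have prod1 : \prod_(i < n) (A k i <= x i <= B k i)%R%:R = 1 :> R.
  by rewrite big1 // => i _; have := kx i; rewrite mxE /A /B valK => ->.
rewrite big_nat_recr //= mul1r prod1; apply: leeDr.
by apply: sume_ge0 => j _; exact: term0.
Qed.

Lemma volume_unit_ball_lty : (0 < n)%N ->
  (volume (unit_ball : set 'rV[R]_n) < +oo)%E.
Proof.
move=> n0; pose o : 'rV[R]_n := const_mx 1.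
apply: le_lt_trans (ltry (box_volume (- o) o)).
apply: le_trans (volume_box_le n0 _); last by move=> i; rewrite !mxE; lra.
apply: volume_mono => x /unit_ballE xx i; rewrite !mxE -ler_norml.
by apply: le_trans (coord_le_enorm x i) _; apply/unit_ballE.
Qed.

End BallVolume.

(** * Volume under triangular matrices *)

Section TriangularVolume.
Context {R : realType} {n : nat}.
Implicit Types (x : 'rV[R]_n) (A : set 'rV[R]_n).

(** A scaling of one coordinate followed by shears that add multiples of other
coordinates to it. *)
Lemma volume_coord_affine (r : 'I_n) (t : R) (c : 'I_n -> R) (s : seq 'I_n) A :
  0 < t -> r \notin s ->
  (volume (coord_upd r (fun x => t * x 0 r + \sum_(i <- s) c i * x 0 i)%R @` A)
    <= t%:E * volume A)%E.
Proof.
move=> t0; elim: s => [_|i s IH].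
  apply: le_trans (volume_scale_coord r A t0); apply: volume_mono.
  move=> _ [x Ax <-]; exists x => //; apply/rowP => j; rewrite !mxE.
  by rewrite big_nil addr0.
rewrite inE negb_or => /andP[ri rs].
apply: le_trans (IH rs).
apply: le_trans (volume_shear (c i) _ (_ : i != r)); last by rewrite eq_sym.
apply: volume_mono => _ [x Ax <-].
exists (coord_upd r (fun x => t * x 0 r + \sum_(i <- s) c i * x 0 i) x).
  by exists x.
apply/rowP => j; rewrite !mxE; case: eqP => // _.
by rewrite eqxx eq_sym (negPf ri) big_cons; ring.
Qed.

(** Coordinate [r] of [x *m T] involves only the coordinates up to [r] of [x],
so the map can be performed one coordinate at a time, from the last one down:
each step still finds the entries that it reads unchanged. *)
Lemma volume_triangular (T : 'M[R]_n) A :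
  (forall i j : 'I_n, (j < i)%N -> T i j = 0) -> (forall i, 0 < T i i) ->
  (volume [set (x *m T)%R | x in A] <= (\prod_i T i i)%:E * volume A)%E.
Proof.
move=> T0 Tpos.
(* [psi k] has processed the coordinates from [k] on. *)
pose psi k x : 'rV[R]_n :=
  \row_(j < n) if (k <= j)%N then (x *m T) 0 j else x 0 j.
have psi0 : psi 0%N = fun x => x *m T.
  by apply/funext => x; apply/rowP => j; rewrite mxE.
have main m : (m <= n)%N -> (volume (psi (n - m)%N @` A) <=
    (\prod_(j < n | (n - m <= j)%N) T j j)%:E * volume A)%E.
  elim: m => [_|m IH mn].
    rewrite big1 ?mul1e; last first.
      by move=> j; rewrite subn0 leqNgt ltn_ord.
    apply: volume_mono => _ [x Ax <-].
    rewrite (_ : psi _ x = x) //; apply/rowP => j.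
    by rewrite mxE subn0 leqNgt ltn_ord.
  have kn : (n - m.+1 < n)%N by lia.
  pose k := Ordinal kn.
  rewrite (bigD1 k) ?leqnn //= EFinM -muleA.
  rewrite (eq_bigl (fun j : 'I_n => (n - m <= j)%N)); last first.
    by move=> j; rewrite -val_eqE /=; lia.
  apply: (@le_trans _ _ ((T k k)%:E * volume (psi (n - m)%N @` A))%E); last first.
    by rewrite lee_pmul2l ?lte_fin //; apply: IH; exact: ltnW.
  pose s := [seq i : 'I_n <- index_enum 'I_n | (i < k)%N].
  have ks : k \notin s by rewrite mem_filter ltnn.
  apply: le_trans (volume_coord_affine (fun i => T i k) _ (Tpos k) ks).
  apply: volume_mono => _ [x Ax <-]; exists (psi (n - m)%N x); first by exists x.
  apply/rowP => j; rewrite !mxE -/k.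
  have [->|jk] := eqVneq j k; last first.
    suff -> : (n - m <= j)%N = (n - m.+1 <= j)%N by [].
    by move: jk; rewrite -val_eqE /=; lia.
  rewrite leqnn ifF; last by rewrite /=; lia.
  rewrite big_filter [RHS](bigID (fun i : 'I_n => (i < k)%N)) /= [RHS]addrC.
  rewrite [in RHS](bigD1 k) ?ltnn //= [X in _ = _ + X + _]big1 ?addr0.
    rewrite mulrC; congr (_ + _); apply: eq_bigr => i ik.
    by rewrite !mxE ifF 1?mulrC //; lia.
  move=> i /andP[ik ink]; rewrite T0 ?mulr0 //.
  by move: ik ink; rewrite -val_eqE /=; lia.
have := main n (leqnn n); rewrite subnn psi0.
by rewrite (eq_bigl xpredT).
Qed.

End TriangularVolume.

(** * QR decomposition *)

Section QR.
Context {R : realType}.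

(** The Householder reflection exchanging two vectors of equal length. *)
Lemma householder (n : nat) (a b : 'rV[R]_n) : dot a a = dot b b ->
  exists H : 'M[R]_n, [/\ H^T = H, H *m H = 1%:M & a *m H = b].
Proof.
move=> ab; have [<-|nab] := eqVneq a b.
  by exists 1%:M; rewrite trmx1 !mulmx1.
pose w := a - b; pose q := dot w w.
have q0 : q != 0 by rewrite dot_eq0 subr_eq0.
have mulT (x y : 'rV[R]_n) : x *m y^T = (dot x y)%:M.
  by rewrite [LHS]mx11_scalar dotE.
have aw : dot a w = q / 2.
  by rewrite /q /w !dotBr !dotBl (dotC b a) -ab; field.
exists (1%:M - (2 / q) *: (w^T *m w)); split.
- by rewrite linearB /= trmx1 linearZ /= trmx_mul trmxK.
- set X := w^T *m w; have XX : X *m X = q *: X.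
    by rewrite /X -mulmxA (mulmxA w) mulT mul_scalar_mx -scalemxAr.
  rewrite mulmxBr mulmx1 mulmxBl mul1mx -scalemxAr -scalemxAl XX !scalerA.
  rewrite -addrA -opprD addrA -scalerDl -scalerBl.
  rewrite (_ : 2 / q + 2 / q - _ = 0) ?scale0r ?subr0 //.
  by field.
- rewrite mulmxBr mulmx1 -scalemxAr mulmxA mulT mul_scalar_mx scalerA aw.
  rewrite (_ : 2 / q * (q / 2) = 1); last by field.
  by rewrite scale1r /w opprB addrC subrK.
Qed.

(** A reflection sends the first column to a positive multiple of the first
basis vector; the lower right block is handled by induction. *)
Lemma qr_decomposition (n : nat) (M : 'M[R]_n) : M \in unitmx ->
  exists O T : 'M[R]_n, [/\ O *m O^T = 1%:M,
    forall i j : 'I_n, (j < i)%N -> T i j = 0, forall i, 0 < T i i & M = O *m T].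
Proof.
elim: n M => [|n IH] M Mu.
  exists 1%:M, 1%:M; split; rewrite ?trmx1 ?mulmx1 //; [by case|by case|].
  by apply/matrixP; case.
move: Mu; rewrite -[n.+1]/(1 + n)%N in M *; move=> Mu.
pose a : 'rV[R]_(1 + n) := (col 0 M)^T.
have a0 : a != 0.
  apply/eqP => a0; have : invmx M *m col 0 M = 0.
    by rewrite -[col 0 M]trmxK -/a a0 trmx0 mulmx0.
  rewrite colE mulmxA mulVmx // mul1mx => /matrixP/(_ 0 0)/eqP.
  by rewrite !mxE !eqxx oner_eq0.
pose rho := enorm a.
have rho0 : 0 < rho by rewrite sqrtr_gt0 lt_def dot_eq0 a0 dot_ge0.
pose e1 : 'rV[R]_(1 + n) := delta_mx 0 0.
have e11 : dot e1 e1 = 1.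
  rewrite /dot (bigD1 0) //= big1 => [|i /negPf i0]; last first.
    by rewrite !mxE eq_sym in i0 *; rewrite i0 andbF mul0r.
  by rewrite !mxE !eqxx mulr1 addr0.
have [|H [HT HH aH]] := @householder _ a (rho *: e1).
  by rewrite dotZl dotZr e11 mulr1 -expr2 enorm_sqr.
have [HM HMdef] : exists HM, HM = H *m M by exists (H *m M).
have HMu : HM \in unitmx by rewrite HMdef unitmx_mul Mu andbT; case: (mulmx1_unit HH).
have HMcol i : HM i 0 = rho * (i == 0)%:R.
  have /matrixP/(_ i 0) : col 0 HM = (rho *: e1)^T.
    by rewrite -aH trmx_mul trmxK HT HMdef !colE mulmxA.
  by rewrite !mxE eqxx.
pose r := ursubmx HM; pose M' := drsubmx HM.
have HME : HM = block_mx rho%:M r 0 M'.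
  rewrite -[LHS]submxK; congr block_mx; apply/matrixP => i j.
    rewrite !mxE !ord1 (_ : lshift n 0 = (0 : 'I_(1 + n))); last exact: val_inj.
    by rewrite HMcol !eqxx mulr1.
  rewrite !mxE !ord1 (_ : lshift n 0 = (0 : 'I_(1 + n))); last exact: val_inj.
  by rewrite HMcol mulr0.
have uM' : M' \in unitmx.
  by move: HMu; rewrite HME unitmxE det_ublock unitrM => /andP[].
have [U [T' [OU T'0 T'pos M'E]]] := IH M' uM'.
exists (H *m block_mx 1%:M 0 0 U), (block_mx rho%:M r 0 T'); split.
- rewrite trmx_mul HT mulmxA -(mulmxA H) tr_block_mx mulmx_block.
  rewrite !trmx0 trmx1 !mulmx0 !mul0mx !mulmx1 !addr0 add0r OU.
  by rewrite -scalar_mx_block mulmx1.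
- move=> i j; case: (split_ordP i) => i' ->; case: (split_ordP j) => j' -> /=.
  + by rewrite !ord1.
  + by rewrite !ord1 /= => ?; lia.
  + by move=> _; rewrite block_mxEdl mxE.
  + by rewrite ltn_add2l block_mxEdr => /T'0.
- move=> i; case: (split_ordP i) => i' ->.
    by rewrite block_mxEul ord1 mxE eqxx mulr1n.
  by rewrite block_mxEdr.
- rewrite -mulmxA mulmx_block !mul1mx !mul0mx mulmx0 !addr0 !add0r -M'E -HME.
  by rewrite HMdef mulmxA HH mul1mx.
Qed.

End QR.

(** * John's criterion *)

Section John.
Context {R : realType} {n : nat}.
Hypothesis n0 : (0 < n)%N.
Variables (I : finType) (u : I -> 'rV[R]_n) (c : I -> R).
Hypotheses (c_gt0 : forall i, 0 < c i) (u_unit : forall i, dot (u i) (u i) = 1).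
Hypothesis u_balanced : \sum_i c i *: u i = 0.
Hypothesis u_identity : forall x, \sum_i (c i * dot (u i) x) *: u i = x.

(** The decomposition of the identity evaluates traces at the contact points. *)
Lemma sum_contact_quadratic (A : 'M[R]_n) :
  \sum_i c i * dot (u i) (u i *m A) = \tr A.
Proof.
have entry j : A j j = \sum_i c i * (u i 0 j * (u i *m A) 0 j).
  have -> : A j j = ((delta_mx 0 j : 'rV[R]_n) *m A) 0 j.
    by rewrite -rowE mxE.
  rewrite -[in LHS](u_identity (delta_mx 0 j)) mulmx_suml summxE.
  apply: eq_bigr => i _; rewrite -scalemxAl mxE mulrA; congr (_ * _ * _).
  by rewrite dotC dot_delta.
rewrite /mxtrace; under [RHS]eq_bigr do rewrite entry.
rewrite exchange_big /=; apply: eq_bigr => i _.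
by rewrite /dot mulr_sumr.
Qed.

Lemma sum_contact_weight : \sum_i c i = n%:R.
Proof.
rewrite -(mxtrace1 R n) -sum_contact_quadratic; apply: eq_bigr => i _.
by rewrite mulmx1 u_unit mulr1.
Qed.

Lemma sum_contact_dot x : \sum_i c i * dot (u i) x = 0.
Proof.
transitivity (dot (\sum_i c i *: u i) x); last by rewrite u_balanced dotC dot0r.
by rewrite dot_suml; apply: eq_bigr => i _; rewrite dotZl.
Qed.

(** The weighted slacks [c i * (1 - dot (u i) x)] are nonnegative with sum [n],
which bounds every [dot (u i) x] from below as well. *)
Lemma contact_bounded x : (forall i, dot (u i) x <= 1) ->
  forall j, `|x 0 j| <= #|I|%:R * n%:R.
Proof.
move=> ux j; rewrite -[in leLHS](u_identity x) summxE.
apply: le_trans (ler_norm_sum _ _ _) _.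
rewrite mulr_natl -sumr_const; apply: ler_sum => i _.
have cn : c i <= n%:R.
  by rewrite -sum_contact_weight (bigD1 i) //= lerDl sumr_ge0 // => k _; exact: ltW.
have slack k : 0 <= c k * (1 - dot (u k) x) by rewrite mulr_ge0 ?subr_ge0 // ltW.
have ci : c i * (1 - dot (u i) x) <= n%:R.
  have <- : \sum_k c k * (1 - dot (u k) x) = n%:R.
    under eq_bigr do rewrite mulrBr mulr1.
    by rewrite sumrB sum_contact_weight sum_contact_dot subr0.
  by rewrite (bigD1 i) //= lerDl sumr_ge0.
have c0 := ltW (c_gt0 i).
have cd : `|c i * dot (u i) x| <= n%:R.
  by have := slack i; rewrite ler_norml => ?; apply/andP; split; lra.
rewrite mxE normrM -[leRHS]mulr1; apply: ler_pM => //.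
apply: le_trans (coord_le_enorm _ _) _.
by rewrite /enorm u_unit sqrtr1.
Qed.

(** The image of the ball under [T], translated by [x0], is an ellipsoid
inside all half-spaces [dot (u i) x <= 1]. *)
Section Inscribed.
Variables (T : 'M[R]_n) (x0 : 'rV[R]_n).
Hypothesis T_upper : forall i j : 'I_n, (j < i)%N -> T i j = 0.
Hypothesis T_pos : forall i, 0 < T i i.
Hypothesis sub : forall x, unit_ball x -> forall i, dot (u i) (x *m T + x0) <= 1.

Let w i := u i *m T^T.

Lemma inscribed_support i : enorm (w i) <= 1 - dot (u i) x0.
Proof.
have [x xB <-] := ball_support (w i).
have := sub xB i; rewrite dotDr (dotC (u i)) dot_mulmx -/(w i); lra.
Qed.

(** Both inequalities used here, for the support function and Cauchy-Schwarz,
are equalities when the gap vanishes. *)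
Lemma inscribed_gap i : 0 <= 1 - dot (u i) x0 - dot (u i) (w i).
Proof.
rewrite subr_ge0; apply: le_trans (inscribed_support i).
exact: dot_unit_le_enorm.
Qed.

Lemma inscribed_gap_sum :
  \sum_i c i * (1 - dot (u i) x0 - dot (u i) (w i)) = n%:R - \tr T.
Proof.
under eq_bigr do rewrite !mulrBr mulr1.
by rewrite !sumrB sum_contact_weight sum_contact_dot subr0 sum_contact_quadratic mxtrace_tr.
Qed.

Lemma inscribed_trace : \tr T <= n%:R.
Proof.
rewrite -subr_ge0 -inscribed_gap_sum; apply: sumr_ge0 => i _.
by rewrite mulr_ge0 ?inscribed_gap // ltW.
Qed.

Lemma inscribed_AGM : \prod_i T i i <= (\tr T / n%:R) ^+ n
  ?= iff [forall i, forall j, T i i == T j j].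
Proof.
have := @leif_AGM R 'I_n predT (fun i => T i i) (fun i _ => ltW (T_pos i)).
rewrite cardT size_enum_ord.
by under [X in _ <= _ ?= iff X]eq_forallb do under eq_forallb do rewrite inE /=.
Qed.

Lemma trace_div_le1 : (\tr T / n%:R) ^+ n <= 1.
Proof.
rewrite exprn_ile1 //.
  by rewrite divr_ge0 // sumr_ge0 // => i _; exact: ltW.
by rewrite ler_pdivrMr ?ltr0n // mul1r inscribed_trace.
Qed.

Lemma inscribed_prod : \prod_i T i i <= 1.
Proof. by apply: le_trans trace_div_le1; rewrite inscribed_AGM. Qed.

(** Equality in the arithmetic-geometric mean inequality makes the diagonal of
[T] constant [1] and closes all gaps.  Equality in Cauchy-Schwarz then makes
every contact point an eigenvector of [T^T], whose only eigenvalue is [1],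
and the contact points span the space. *)
Lemma inscribed_prod_eq1 : 1 <= \prod_i T i i -> T = 1%:M /\ x0 = 0.
Proof.
move=> T1; have [leAG eqAG] := inscribed_AGM.
have pr1 : \prod_i T i i = 1 by apply/eqP; rewrite eq_le T1 inscribed_prod.
have AG1 : (\tr T / n%:R) ^+ n = 1.
  by apply/eqP; rewrite eq_le trace_div_le1 -{1}pr1 leAG.
have tr0 : 0 <= \tr T / n%:R.
  by rewrite divr_ge0 // sumr_ge0 // => i _; exact: ltW.
have tr1 : \tr T = n%:R.
  have /eqP := AG1; rewrite pexpr_eq1 // => /eqP.
  by move/(congr1 (fun z => z * n%:R)); rewrite mul1r divfK // pnatr_eq0 -lt0n.
have Tii i : T i i = 1.
  move: eqAG; rewrite pr1 AG1 eqxx => /esym/forallP/(_ i)/forallP eqT.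
  have : \tr T = \sum_(j < n) T i i by apply: eq_bigr => j _; apply/esym/eqP.
  rewrite tr1 sumr_const card_ord -[RHS]mulr_natl => h.
  by apply: (@mulfI _ n%:R); rewrite ?pnatr_eq0 -?lt0n // mulr1 -h.
have gap0 i : 1 - dot (u i) x0 - dot (u i) (w i) = 0.
  have := inscribed_gap_sum; rewrite tr1 subrr => /psumr_eq0P h.
  have /eqP := h (fun j _ => mulr_ge0 (ltW (c_gt0 j)) (inscribed_gap j)) i isT.
  by rewrite mulf_eq0 gt_eqF //= => /eqP.
have wE i : w i = dot (u i) (w i) *: u i.
  apply: cauchy_schwarz_eq => //; apply/eqP; rewrite eq_le.
  rewrite dot_unit_le_enorm //=.
  by apply: le_trans (inscribed_support i) _; have := gap0 i; lra.
have la1 i : dot (u i) (w i) = 1.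
  apply/eqP; case: eqVneq => // la; exfalso.
  pose N := T^T - (dot (u i) (w i))%:M.
  have Nu : N \in unitmx.
    rewrite unitmxE det_trig.
      rewrite unitfE; apply/prodf_neq0 => j _.
      by rewrite !mxE eqxx Tii mulr1n subr_eq0 eq_sym.
    apply/is_trig_mxP => j k jk; rewrite !mxE T_upper // -val_eqE (ltn_eqF jk).
    by rewrite subrr.
  have : u i *m N = 0 by rewrite mulmxBr mul_mx_scalar -/(w i) {1}wE subrr.
  move=> /(congr1 (fun z => z *m invmx N)); rewrite mulmxK // mul0mx => ui0.
  by have /eqP := u_unit i; rewrite ui0 dot0r eq_sym oner_eq0.
have x00 : x0 = 0.
  rewrite -(u_identity x0) big1 // => i _; have := gap0 i; rewrite la1.
  by rewrite addrAC subrr sub0r => /eqP; rewrite oppr_eq0 => /eqP ->; rewrite mulr0 scale0r.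
split => //; apply: trmx_inj; rewrite trmx1; apply/row_matrixP => i.
rewrite !rowE mulmx1 -[in LHS](u_identity (delta_mx 0 i)) mulmx_suml.
rewrite -[RHS](u_identity (delta_mx 0 i)); apply: eq_bigr => j _.
by rewrite -scalemxAl -/(w j) wE la1 scale1r.
Qed.

End Inscribed.

(** The orthogonal factor of the QR decomposition preserves the ball. *)
Lemma ellipsoid_triangular (E : set 'rV[R]_n) : ellipsoid E ->
  exists (T : 'M[R]_n) (x0 : 'rV[R]_n),
  [/\ forall i j : 'I_n, (j < i)%N -> T i j = 0, forall i, 0 < T i i
    & E = [set x *m T + x0 | x in unit_ball]].
Proof.
move=> [M [x0 [Mu ->]]]; have [Q [T [QQ T0 Tpos ->]]] := qr_decomposition Mu.
have QB x : unit_ball x -> unit_ball (x *m Q).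
  by rewrite !unit_ballE dot_mulmx -mulmxA QQ mulmx1.
have QTB x : unit_ball x -> unit_ball (x *m Q^T).
  by rewrite !unit_ballE dot_mulmx trmxK -mulmxA (mulmx1C QQ) mulmx1.
exists T, x0; split => //; apply/seteqP; split => _ [x xB <-].
  by exists (x *m Q); [exact: QB|rewrite -mulmxA].
by exists (x *m Q^T); [exact: QTB|rewrite mulmxA -(mulmxA x) (mulmx1C QQ) mulmx1].
Qed.

(** Sufficiency in John's theorem.  The volume of the ball is positive and
finite, so comparing volumes amounts to comparing [\prod_i T i i] with [1]. *)
Lemma john_position_of_contacts (K : set 'rV[R]_n) : unit_ball `<=` K ->
  (forall x, K x -> forall i, dot (u i) x <= 1) -> john_position K.
Proof.
move=> BK Ku.
have inscribed E : ellipsoid E -> E `<=` K ->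
    (volume E <= volume (unit_ball : set 'rV[R]_n))%E /\
    ((volume (unit_ball : set 'rV[R]_n) <= volume E)%E -> E = unit_ball).
  move=> /ellipsoid_triangular[T [x0 [T0 Tpos EE]]] EK.
  have sub x : unit_ball x -> forall i, dot (u i) (x *m T + x0) <= 1.
    by move=> xB; apply/Ku/EK; rewrite EE; exists x.
  have volE : (volume E <= (\prod_i T i i)%:E * volume (unit_ball : set 'rV[R]_n))%E.
    apply: le_trans (volume_triangular _ T0 Tpos).
    apply: le_trans (volume_translate x0 _ n0); apply: volume_mono.
    by rewrite EE => _ [x xB <-]; exists (x *m T) => //; exists x.
  have prod1 := inscribed_prod Tpos sub.
  split.
    apply: le_trans volE _; rewrite -[leRHS]mul1e lee_wpmul2r ?lee_fin //.
    exact: volume_ge0.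
  move=> /le_trans/(_ volE) BE.
  have [|T1 x00] := inscribed_prod_eq1 T0 Tpos sub.
    have Bfin : volume (unit_ball : set 'rV[R]_n) \is a fin_num.
      by rewrite ge0_fin_numE ?volume_ge0 // volume_unit_ball_lty.
    have := volume_unit_ball_gt0 (R := R) n0; move: BE.
    rewrite -(fineK Bfin) -EFinM lee_fin lte_fin => BE B0.
    by rewrite -(ler_pM2r B0) mul1r.
  rewrite EE T1 x00.
  by apply/seteqP; split => [_ [x xB <-]|x xB]; [|exists x => //]; rewrite mulmx1 addr0.
have ballE : ellipsoid (unit_ball : set 'rV[R]_n).
  exists 1%:M, 0; split; first exact: unitmx1.
  by apply/seteqP; split => [x xB|_ [x xB <-]]; [exists x => //|]; rewrite mulmx1 addr0.
split; first by split => // E /inscribed h /h[].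
move=> E [EE EK Emax]; case: (inscribed E EE EK) => _; apply.
exact: Emax.
Qed.

End John.

(** * Facets of a polytope *)

Section Facets.
Context {R : realType} {n : nat}.

Lemma hyperplane_flat (u : 'rV[R]_n) (b : R) : u != 0 ->
  flat n.-1 (hyperplane u b).
Proof.
move=> u0; have uu : dot u u != 0 by rewrite dot_eq0.
pose phi (x : 'rV[R]_n) : 'rV[R]_1 := x *m u^T.
have phiE x : phi x 0 0 = dot u x by rewrite -dotE dotC.
pose f : 'Hom('rV[R]_n, 'rV[R]_1) := linfun (mulmxr u^T).
have dn k : \dim {:'rV[R]_k} = k by rewrite dimvf dim_matrix; exact: mul1n.
have fE x : f x = phi x by rewrite lfunE.
exists ((b / dot u u) *: u), (lker f).
  have : (\dim (fullv :&: lker f) + \dim (f @: fullv) = \dim {:'rV[R]_n})%N.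
    exact: limg_ker_dim.
  have -> : (f @: fullv = fullv)%VS.
    apply/eqP; rewrite eqEdim subvf /= dn.
    rewrite lt0n dimv_eq0; apply/eqP => f0.
    have : f u \in (f @: fullv)%VS by rewrite memv_img ?memvf.
    rewrite f0 memv0 fE => /eqP/rowP/(_ 0); rewrite phiE mxE => /eqP.
    by rewrite dot_eq0 (negPf u0).
  by rewrite capfv !dn addn1 => /(congr1 predn).
have kerE x : (x \in lker f) = (dot u x == 0).
  rewrite memv_ker fE; apply/eqP/eqP => [/rowP/(_ 0)|h].
    by rewrite phiE mxE.
  by apply/rowP => i; rewrite ord1 phiE h mxE.
apply/seteqP; split => [x xb|_ [v /= + <-]].
  exists (x - (b / dot u u) *: u); last by rewrite addrC subrK.
  by rewrite /= kerE dotBr dotZr divfK // xb subrr.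
by rewrite kerE => /eqP v0; rewrite /hyperplane /= dotDr v0 dotZr divfK // addr0.
Qed.

Lemma flat_line (d : nat) (B : set 'rV[R]_n) (w h : 'rV[R]_n) (e : R) :
  flat d B -> e != 0 -> B w -> B (w + e *: (h - w)) -> B h.
Proof.
move=> [x0 [U _ ->]] e0 [a /= aU aw] [a' /= a'U a'w].
exists (a + e^-1 *: (a' - a)); first by rewrite /= memvD // memvZ // memvB.
have -> : a' - a = e *: (h - w).
  by apply: (addrI (x0 + a)); rewrite {2}aw -a'w addrA addrAC addrK.
by rewrite scalerA mulVf // scale1r addrA aw addrC subrK.
Qed.

(** The point [z] violates the constraint [j] and no other one; [w] is where
the segment from the origin to [z] meets the hyperplane of that constraint. *)
Section Irredundant.
Variables (I : finType) (u : I -> 'rV[R]_n) (b : I -> R) (P : set 'rV[R]_n).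
Hypotheses (u_neq0 : forall j, u j != 0) (b_gt0 : forall j, 0 < b j).
Variable S : {set I}.
Hypothesis PE : forall x, P x <-> forall j, j \in S -> dot (u j) x <= b j.
Variable j : I.
Hypothesis jS : j \in S.
Variable z : 'rV[R]_n.
Hypothesis z_in : forall i, i \in S -> i != j -> dot (u i) z <= b i.
Hypothesis z_out : b j < dot (u j) z.

Let w := (b j / dot (u j) z) *: z.

Lemma wall_on : dot (u j) w = b j.
Proof. by rewrite dotZr divfK // gt_eqF // (lt_trans (b_gt0 j)). Qed.

Lemma wall_off i : i \in S -> i != j -> dot (u i) w < b i.
Proof.
move=> iS ij; have z0 : 0 < dot (u j) z by rewrite (lt_trans (b_gt0 j)).
rewrite dotZr; apply: (@le_lt_trans _ _ (b j / dot (u j) z * b i)).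
  by rewrite ler_wpM2l ?z_in // divr_ge0 // ltW.
by rewrite gtr_pMl // ltr_pdivrMr // mul1r.
Qed.

Lemma wall_in : (P `&` hyperplane (u j) (b j)) w.
Proof.
split; last exact: wall_on.
apply/PE => i iS; have [->|ij] := eqVneq i j; first by rewrite wall_on.
by rewrite ltW // wall_off.
Qed.

(** [w] is in the relative interior of the wall, so that the wall spans the
whole hyperplane. *)
Lemma wall_affine_hull :
  affine_hull (P `&` hyperplane (u j) (b j)) = hyperplane (u j) (b j).
Proof.
apply/seteqP; split => [x|h hH B [[d Bflat] FB]].
  apply; split; last by move=> y [].
  by exists n.-1; exact: hyperplane_flat.
(* A step of size [(1 + s)^-1] from [w] towards [h] keeps every other
   constraint: the ratio of its slope to its gap at [w] is a term of [s]. *)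
pose slope i := `|dot (u i) (h - w)| / (b i - dot (u i) w).
pose s := \sum_(i in S | i != j) slope i.
have slope0 i : (i \in S) && (i != j) -> 0 <= slope i.
  by move=> /andP[iS ij]; rewrite divr_ge0 // subr_ge0 ltW // wall_off.
have s0 : 0 <= s by apply: sumr_ge0.
have s1 : 0 < 1 + s by rewrite ltr_pwDl.
apply: (@flat_line d B w h (1 + s)^-1) => //.
- by rewrite invr_eq0 gt_eqF.
- exact/FB/wall_in.
apply: FB; split; last first.
  by rewrite /hyperplane /= dotDr dotZr dotBr wall_on hH subrr mulr0 addr0.
apply/PE => i iS; rewrite dotDr dotZr.
have [->|ij] := eqVneq i j; first by rewrite dotBr wall_on hH subrr mulr0 addr0.
rewrite -lerBrDl mulrC ler_pdivrMr //.
have gap : 0 < b i - dot (u i) w by rewrite subr_gt0 wall_off.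
apply: le_trans (ler_norm _) _; rewrite mulrC -ler_pdivrMr // -/(slope i).
apply: (@le_trans _ _ s); last by rewrite lerDr.
by rewrite /s (bigD1 i) ?iS //= lerDl sumr_ge0 // => k /andP[/slope0].
Qed.

Lemma wall_facet : facets P (P `&` hyperplane (u j) (b j)).
Proof.
split; last by rewrite /has_dim wall_affine_hull; exact: hyperplane_flat.
by exists (u j), (b j); split => // x /PE/(_ j jS).
Qed.

End Irredundant.

(** In a minimal description by half-spaces every half-space carries a facet,
and different half-spaces carry different facets; as the origin is an interior
point, the right-hand sides can be scaled to [1]. *)
Lemma facet_description (P : set 'rV[R]_n) (m : nat) : polytope P ->
  unit_ball `<=` P -> facets P #= `I_m ->
  exists (k : nat) (v : 'I_k -> 'rV[R]_n),
    (k <= m)%N /\ forall x, P x <-> forall j, dot (v j) x <= 1.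
Proof.
move=> [_ [p [u [b [u0 PE]]]]] BP Pm.
have b0 j : 0 < b j.
  have [x xB xu] := ball_support (u j).
  have := BP x xB; rewrite PE => /(_ j I); rewrite /halfspace /= dotC xu.
  by apply: lt_le_trans; rewrite sqrtr_gt0 lt_def dot_eq0 u0 dot_ge0.
pose Q (S : {set 'I_p}) :=
  `[< forall x, P x <-> forall j, j \in S -> dot (u j) x <= b j >].
have QT : Q [set: 'I_p]%SET.
  apply/asboolP => x; rewrite PE; split => h j; first by move=> _; exact: h.
  by move=> _; apply: h; rewrite inE.
have [S /minsetP[/asboolP QS Smin] _] := minset_exists QT.
have irr j : j \in S -> exists2 z : 'rV[R]_n,
    forall i, i \in S -> i != j -> dot (u i) z <= b i & b j < dot (u j) z.
  move=> jS; apply: contrapT => nz.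
  suff /Smin : Q (S :\ j)%SET.
    by move=> /(_ (subD1set _ _)) SE; move: jS; rewrite -SE !inE eqxx.
  apply/asboolP => x; split => [/QS h i|h]; first by rewrite !inE => /andP[_ /h].
  apply/QS => i iS; have [->|ij] := eqVneq i j; last by apply: h; rewrite !inE ij.
  rewrite leNgt; apply/negP => jx; apply: nz; exists x => // k kS kj.
  by apply: h; rewrite !inE kj.
exists #|S|, (fun k => (b (enum_val k))^-1 *: u (enum_val k)); split; last first.
  move=> x; rewrite QS; split => h j.
    by rewrite dotZl ler_pdivrMl // mulr1 h // enum_valP.
  move=> jS; have := h (enum_rank_in jS j).
  by rewrite enum_rankK_in // dotZl ler_pdivrMl // mulr1.
pose F (k : 'I_#|S|) := P `&` hyperplane (u (enum_val k)) (b (enum_val k)).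
have Finj : injective F.
  move=> k l Fkl; apply/eqP; case: eqVneq => // kl; exfalso.
  have [z z1 z2] := irr _ (enum_valP l).
  have := wall_in b0 QS z1 z2; rewrite -/(F l) -Fkl => -[_].
  rewrite /hyperplane /= => wk.
  have : enum_val k != enum_val l by rewrite (inj_eq enum_val_inj).
  move=> /(wall_off b0 z1 z2 (enum_valP k)); by rewrite wk ltxx.
have FP : F @` setT `<=` facets P.
  move=> _ [k _ <-]; have [z z1 z2] := irr _ (enum_valP k).
  exact: (wall_facet u0 b0 QS (enum_valP k) z1 z2).
rewrite -card_le_II -(card_le_eqr Pm) -(card_le_eql (card_esym card_II)).
apply: card_le_trans (subset_card_le FP).
have Finj' : {in [set: 'I_#|S|] &, injective F} by move=> ? ? _ _; exact: Finj.
by have := inj_card_eq Finj'; rewrite card_eq_le => /andP[].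
Qed.

End Facets.

(** * Bodies cut out by half-spaces *)

Section HalfspaceBody.
Context {R : realType} {n : nat}.
Variables (I : Type) (w : I -> 'rV[R]_n).

Definition polar_of : set 'rV[R]_n := [set x | forall i, dot (w i) x <= 1].

Lemma dot_continuous (v : 'rV[R]_n) : continuous (dot v : 'rV[R]_n -> R).
Proof.
apply: continuous_big; first exact: add_continuous.
move=> i _ x; apply: (@continuousM _ _ (fun=> v 0 i)); first exact: cst_continuous.
exact: coord_continuous.
Qed.

Lemma unit_ball_sub_polar : (forall i, dot (w i) (w i) <= 1) ->
  unit_ball `<=` polar_of.
Proof.
move=> w1 x xB i; apply: le_trans (dot_le_enorm _ _) _.
have wi : enorm (w i) <= 1 by have /unit_ballE := w1 i.
by rewrite mulr_ile1 ?enorm_ge0.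
Qed.

Lemma polar_convex : @convex_set R 'rV[R]_n polar_of.
Proof.
apply/convex_setW => x y; rewrite !inE => xP yP k k0 k1; rewrite inE => i.
rewrite /conv /= dotDr !dotZr.
have := ler_wpM2l (ltW k0) (xP i); have k1' : 0 <= 1 - k%:num by rewrite subr_ge0 ltW.
by have := ler_wpM2l k1' (yP i); rewrite /unstable.onem; lra.
Qed.

Lemma polar_compact (M : R) :
  (forall x, polar_of x -> forall j, `|x 0 j| <= M) -> compact polar_of.
Proof.
move=> PM.
have cube : compact [set v : 'rV[R]_n | forall i, v ord0 i \in `[(- M), M]].
  apply: (@rV_compact _  _ (fun=> `[(- M), M]%classic)).
  by move=> _; apply: segment_compact.
apply: subclosed_compact cube _; last first.
  by move=> x /PM xM j; rewrite in_itv /= -ler_norml.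
rewrite (_ : polar_of = \bigcap_(i in setT) (dot (w i) @^-1` [set r | r <= 1])).
  apply: closed_bigI => i _; apply: preimage_closed; last exact: closed_le.
  by move=> x _; exact: dot_continuous.
by apply/seteqP; split => [x h i _|x h i]; [exact: h|exact: h].
Qed.

Lemma interior_of_unit_ball (K : set 'rV[R]_n) : (0 < n)%N ->
  unit_ball `<=` K -> K° !=set0.
Proof.
move=> n0 BK; exists 0; apply/nbhs_ballP; exists n%:R^-1 => /=.
  by rewrite invr_gt0 ltr0n.
move=> x [_ xe]; apply/BK/unit_ball_of_coords => j.
by have := xe 0 j; rewrite /ball /= mxE sub0r normrN => /ltW.
Qed.

End HalfspaceBody.

(** Every [rho *: y s] lies outside the polytope, since [v s] separates [y s]
from [K], and hence outside one of its half-spaces.  If one half-space missed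
more than [2 * rho] of these points, a multiple of their sum would belong to
[K] and yet lie outside the half-space: the bound on [dot (u l) (y s)] keeps
the sum inside the [u l], and at most one term of the sum is positive on each
[v s]. *)
Lemma hidden_points_bound {R : realType} {n : nat} (rho : R) (L X : finType)
    (u : L -> 'rV[R]_n) (v y : X -> 'rV[R]_n) (k : nat) (a : 'I_k -> 'rV[R]_n) :
  let K := polar_of (fun t : L + X => match t with inl l => u l | inr s => v s end) in
  0 < rho ->
  (forall l s, dot (u l) (y s) <= rho^-1) ->
  (forall s, 1 < dot (v s) (y s)) -> (forall s, dot (v s) (y s) <= 2) ->
  (forall s t, s != t -> dot (v s) (y t) <= 0) ->
  K `<=` polar_of a -> polar_of a `<=` dilate rho K ->
  #|X|%:R <= k%:R * (2 * rho).
Proof.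
move=> K rho0 uy vy1 vy2 vy0 KP PK.
have hide s : exists j, 1 < dot (a j) (rho *: y s).
  apply: contrapT => nh.
  have : polar_of a (rho *: y s).
    by move=> j; rewrite leNgt; apply/negP => h; apply: nh; exists j.
  move=> /PK[x xK] /(scalerI (lt0r_neq0 rho0)) xy.
  by have := xK (inr s); rewrite xy leNgt vy1.
have [phi phiP] := choice hide.
have fiber j : #|[set s | phi s == j]%SET|%:R <= 2 * rho.
  rewrite leNgt; apply/negP; set A := [set s | phi s == j]%SET => NA.
  have N0 : 0 < #|A|%:R :> R by apply: lt_trans NA; rewrite mulr_gt0.
  pose x := (rho / #|A|%:R) *: \sum_(s in A) y s.
  have r0 : 0 <= rho / #|A|%:R by rewrite divr_ge0 ?ltW.
  have : K x.
    move=> [l|t]; rewrite dotZr dot_sumr.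
      have : \sum_(s in A) dot (u l) (y s) <= #|A|%:R * rho^-1.
        by rewrite mulr_natl -sumr_const; apply: ler_sum => s _; exact: uy.
      move=> /(ler_wpM2l r0) /le_trans; apply.
      by rewrite mulrA divfK ?gt_eqF // divff ?gt_eqF.
    have : \sum_(s in A) dot (v t) (y s) <= 2.
      have le0 s : (s \in A) && (s != t) -> dot (v t) (y s) <= 0.
        by move=> /andP[_ st]; rewrite vy0 // eq_sym.
      have [tA|tA] := boolP (t \in A).
        by rewrite (bigD1 t) //= -[leRHS]addr0 lerD // sumr_le0.
      apply: (@le_trans _ _ 0) => //; apply: sumr_le0 => s sA; apply: le0.
      by rewrite sA; apply: contraNneq tA => <-.
    move=> /(ler_wpM2l r0) /le_trans; apply.
    by rewrite -mulrAC ler_pdivrMr // mul1r mulrC ltW.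
  move=> /KP/(_ j); apply/negP; rewrite -ltNge dotZr dot_sumr.
  have -> : rho / #|A|%:R * \sum_(s in A) dot (a j) (y s) =
      #|A|%:R^-1 * \sum_(s in A) dot (a j) (rho *: y s).
    by rewrite -mulrA mulrC -mulrA; congr (_ * _);
      rewrite mulr_suml; apply: eq_bigr => s _; rewrite dotZr mulrC.
  rewrite ltr_pdivlMl // mulr1 -[X in X < _]mulr1 mulr_natl -sumr_const.
  apply: ltr_sum.
    move: N0; rewrite ltr0n => /card_gt0P[s sA].
    by apply/hasP; exists s => //; exact: mem_index_enum.
  by move=> s; rewrite inE => /eqP <-; exact: phiP.
rewrite -sum1_card natr_sum (partition_big phi xpredT) //=.
have -> : k%:R * (2 * rho) = \sum_(j < k) 2 * rho.
  by rewrite sumr_const card_ord mulr_natl.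
apply: ler_sum => j _; apply: le_trans (fiber j).
by rewrite -natr_sum sum1dep_card.
Qed.

(** * A Gilbert-Varshamov code *)

Section Code.
Context {I A : finType}.
Implicit Types f g : {ffun I -> A}.

Definition agreement f g : {set I} := [set i | f i == g i]%SET.

Lemma leq_card_bigcup (J T : finType) (P : pred J) (B : J -> {set T}) :
  (#|\bigcup_(j | P j) B j| <= \sum_(j | P j) #|B j|)%N.
Proof.
elim/big_rec2: _ => [|j m U _ IH]; first by rewrite cards0.
by apply: leq_trans (leq_card_setU _ _) _; rewrite leq_add2l.
Qed.

Lemma card_agree_on f (S : {set I}) :
  #|[set g | S \subset agreement f g]%SET| = (#|A| ^ (#|I| - #|S|))%N.
Proof.
have -> : [set g | S \subset agreement f g]%SET =
    [set g in family (fun i => if i \in S then pred1 (f i) else predT)]%SET.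
  apply/setP => g; rewrite !inE; apply/idP/idP => [/fintype.subsetP h|/familyP h].
    apply/familyP => i; case: ifP => iS; last by rewrite inE.
    by have := h i iS; rewrite !inE eq_sym.
  by apply/fintype.subsetP => i iS; have := h i; rewrite iS !inE eq_sym.
rewrite cardsE card_family foldrE big_map big_enum /= (bigID (mem S)) /=.
rewrite big1 ?mul1n; last by move=> i iS; rewrite iS card1.
rewrite (eq_bigr (fun=> #|A|)); last first.
  by move=> i /negPf iS; rewrite iS; apply: eq_card => ?; rewrite !inE.
rewrite prod_nat_const; congr (_ ^ _)%N.
by rewrite -(cardsC S) addKn; apply: eq_card => i; rewrite !inE.
Qed.

(** Union bound over the possible agreement sets. *)
Lemma card_agree_often f (k : nat) :
  (#|[set g | (k < #|agreement f g|)%N]%SET| <= 2 ^ #|I| * #|A| ^ (#|I| - k.+1))%N.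
Proof.
case: (posnP #|A|) => [A0|A0].
  have [I0|I0] := posnP #|I|.
    rewrite (_ : [set _ | _]%SET = finset.set0) ?cards0 //.
    apply/setP => g; rewrite !inE; apply/negbTE.
    by rewrite -leqNgt (leq_trans (max_card _)) // I0.
  apply: leq_trans (max_card _) _; rewrite card_ffun A0 exp0n //.
pose Sub := [set S : {set I} | (k < #|S|)%N]%SET.
apply: (@leq_trans (\sum_(S in Sub) #|[set g | S \subset agreement f g]%SET|)).
  apply: leq_trans (leq_card_bigcup _ _).
  apply/subset_leq_card/fintype.subsetP => g; rewrite inE => kg.
  by apply/finset.bigcupP; exists (agreement f g); rewrite inE.
apply: (@leq_trans (\sum_(S in Sub) #|A| ^ (#|I| - k.+1))).
  apply: leq_sum => S; rewrite inE card_agree_on => kS.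
  by rewrite leq_pexp2l // leq_sub2l.
rewrite sum_nat_const leq_mul2r; apply/orP; right.
by apply: leq_trans (max_card _) _; rewrite -cardsT -powersetT card_powerset cardsT.
Qed.

(** The Gilbert-Varshamov argument: around the words of a maximal code the
balls of words that agree too often cover everything. *)
Lemma code_exists (k : nat) : (k < #|I|)%N ->
  exists F : {set {ffun I -> A}},
    (forall f g, f \in F -> g \in F -> f != g -> (#|agreement f g| <= k)%N) /\
    (#|A| ^ #|I| <= #|F| * (2 ^ #|I| * #|A| ^ (#|I| - k.+1)))%N.
Proof.
move=> kI.
pose Q (F : {set {ffun I -> A}}) := [forall f in F, forall g in F,
  (f != g) ==> (#|agreement f g| <= k)%N].
have Q0 : Q finset.set0 by apply/forall_inP => f; rewrite inE.
have [F /maxsetP[QF Fmax] _] := maxset_exists Q0.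
have agC f g : agreement f g = agreement g f.
  by apply/setP => i; rewrite !inE eq_sym.
exists F; split.
  move=> f g fF gF fg.
  by move/forall_inP: QF => /(_ f fF)/forall_inP/(_ g gF)/implyP; apply.
rewrite -card_ffun -sum_nat_const.
apply: (@leq_trans (\sum_(f in F) #|[set g | (k < #|agreement f g|)%N]%SET|)); last first.
  by apply: leq_sum => f _; exact: card_agree_often.
apply: leq_trans (leq_card_bigcup _ _).
rewrite -cardsT; apply/subset_leq_card/fintype.subsetP => g _; apply/finset.bigcupP.
have [gF|gF] := boolP (g \in F).
  exists g => //; rewrite inE (_ : agreement g g = [set: I]%SET) ?cardsT //.
  by apply/setP => i; rewrite !inE eqxx.
have [/exists_inP[f fF fg]|] := boolP [exists f in F, (k < #|agreement f g|)%N].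
  by exists f; rewrite // inE.
rewrite negb_exists_in => /forall_inP near0; exfalso.
have near f : f \in F -> (#|agreement f g| <= k)%N by move=> /near0; rewrite -leqNgt.
have : Q (g |: F)%SET.
  apply/forall_inP => f1; rewrite !inE => f1F.
  apply/forall_inP => f2; rewrite !inE => f2F; apply/implyP => f12.
  case/orP: f1F f12 => [/eqP->|f1F]; case/orP: f2F => [/eqP->|f2F] f12.
  - by rewrite eqxx in f12.
  - by rewrite agC near.
  - by rewrite near.
  - by move/forall_inP: QF => /(_ f1 f1F)/forall_inP/(_ f2 f2F)/implyP; apply.
move=> /Fmax /(_ (finset.subsetUr _ _)) gFE.
by move: gF; rewrite -gFE !inE eqxx.
Qed.

End Code.

(** * The regular simplex and the hidden points *)

Section Simplex.
Context {R : realType} {n : nat}.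
Hypothesis n_gt0 : (0 < n)%N.
Implicit Types (x : 'rV[R]_n) (J : {set 'I_n}).

Let s : R := Num.sqrt n%:R.
Definition ones : 'rV[R]_n := const_mx 1.
(** [alpha] and [beta] are chosen so that the [n.+1] vectors below are unit
vectors with sum zero. *)
Definition alpha : R := Num.sqrt (1 + n%:R^-1).
Definition beta : R := (s^-1 - alpha) / n%:R.

(** Outer unit normals of a regular simplex circumscribed about the ball. *)
Definition simplex_normal (i : 'I_n.+1) : 'rV[R]_n :=
  if unlift ord0 i is Some l then alpha *: delta_mx 0 l + beta *: ones
  else - s^-1 *: ones.

Let nR : 0 < n%:R :> R. Proof. by rewrite ltr0n. Qed.
Let s_gt0 : 0 < s. Proof. by rewrite sqrtr_gt0. Qed.
Let s_sqr : s ^+ 2 = n%:R. Proof. by rewrite sqr_sqrtr // ltW. Qed.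
Let alpha_sqr : alpha ^+ 2 = 1 + n%:R^-1.
Proof. by rewrite sqr_sqrtr // addr_ge0 // invr_ge0 ltW. Qed.
Let n_beta : n%:R * beta = s^-1 - alpha.
Proof. by rewrite mulrC divfK // gt_eqF. Qed.
Let s_inv_sqr : s^-1 ^+ 2 = n%:R^-1. Proof. by rewrite exprVn s_sqr. Qed.
Let beta_sum : beta * (alpha + s^-1) = - n%:R^-1.
Proof.
have nn0 : n%:R != 0 :> R by rewrite gt_eqF.
apply: (mulfI nn0); rewrite mulrA n_beta mulrN divff //.
transitivity (s^-1 ^+ 2 - alpha ^+ 2); first by ring.
by rewrite s_inv_sqr alpha_sqr; ring.
Qed.

Lemma dot_ones x : dot ones x = \sum_j x 0 j.
Proof. by apply: eq_bigr => j _; rewrite mxE mul1r. Qed.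

Lemma dot_ones_ones : dot ones ones = n%:R.
Proof. by rewrite dot_ones; under eq_bigr do rewrite mxE; rewrite sumr_const card_ord. Qed.

Lemma dot_normal0 x : dot (simplex_normal ord0) x = - s^-1 * dot ones x.
Proof. by rewrite /simplex_normal unlift_none dotZl. Qed.

Lemma dot_normal_lift l x : dot (simplex_normal (lift ord0 l)) x =
  alpha * x 0 l + beta * dot ones x.
Proof. by rewrite /simplex_normal liftK dotDl !dotZl dot_delta. Qed.

Lemma simplex_normal_unit i : dot (simplex_normal i) (simplex_normal i) = 1.
Proof.
have [l ->|->] := unliftP ord0 i; last first.
  rewrite dot_normal0 /simplex_normal unlift_none dotZr dot_ones_ones mulrA -s_sqr.
  by field; rewrite gt_eqF.
rewrite dot_normal_lift /simplex_normal liftK dotDr !dotZr dot_ones_ones.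
rewrite dotC dot_delta !mxE !eqxx /= !mulr1.
rewrite [beta * n%:R]mulrC n_beta [alpha + _]addrC subrK.
rewrite mulrDr -expr2 -addrA [alpha * _]mulrC -mulrDr beta_sum.
by rewrite alpha_sqr addrK.
Qed.

Lemma simplex_normal_balanced : \sum_i simplex_normal i = 0.
Proof.
apply/rowP => j; rewrite summxE big_ord_recl /simplex_normal unlift_none.
under eq_bigr do rewrite liftK !mxE mulr1.
rewrite big_split /= sumr_const card_ord -mulr_natl n_beta (bigD1 j) //= eqxx.
rewrite big1 => [|k /negPf kj]; last by rewrite eq_sym kj mulr0.
by rewrite !mxE /=; ring.
Qed.

Lemma simplex_normal_identity x :
  \sum_i dot (simplex_normal i) x *: simplex_normal i = (1 + n%:R^-1) *: x.
Proof.
apply/rowP => j; rewrite summxE big_ord_recl.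
have -> : \sum_(l < n) (dot (simplex_normal (lift ord0 l)) x
      *: simplex_normal (lift ord0 l)) 0 j =
    \sum_l (alpha * (alpha * x 0 l + beta * dot ones x) * (j == l)%:R
      + beta * (alpha * x 0 l + beta * dot ones x)).
  apply: eq_bigr => l _; rewrite mxE dot_normal_lift /simplex_normal liftK !mxE /=.
  by ring.
rewrite big_split /= (bigD1 j) //= eqxx big1 => [|k /negPf kj]; last first.
  by rewrite eq_sym kj mulr0.
rewrite -mulr_sumr big_split /= -mulr_sumr -dot_ones sumr_const card_ord -mulr_natl.
rewrite mxE dot_normal0 /simplex_normal unlift_none !mxE -alpha_sqr.
set S := dot ones x.
transitivity (alpha ^+ 2 * x 0 j + S * (s^-1 ^+ 2 + beta * (alpha + (alpha + n%:R * beta)))).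
  by ring.
by rewrite n_beta s_inv_sqr [alpha + (_ - _)]addrC subrK beta_sum subrr mulr0 addr0.
Qed.

Let weight : R := (1 + n%:R^-1)^-1.
Let weight_gt0 : 0 < weight. Proof. by rewrite invr_gt0 addr_gt0 // invr_gt0. Qed.

Let weighted_balanced : \sum_i weight *: simplex_normal i = 0.
Proof. by rewrite -scaler_sumr simplex_normal_balanced scaler0. Qed.

Let weighted_identity x :
  \sum_i (weight * dot (simplex_normal i) x) *: simplex_normal i = x.
Proof.
under eq_bigr do rewrite -scalerA.
by rewrite -scaler_sumr simplex_normal_identity scalerA mulVf ?scale1r
  ?lt0r_neq0 // addr_gt0 ?invr_gt0.
Qed.

Lemma simplex_john (K : set 'rV[R]_n) : unit_ball `<=` K ->
  (forall x, K x -> forall i, dot (simplex_normal i) x <= 1) -> john_position K.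
Proof.
exact: (john_position_of_contacts n_gt0 (fun=> weight_gt0) simplex_normal_unit
  weighted_balanced weighted_identity).
Qed.

Lemma simplex_bounded x : (forall i, dot (simplex_normal i) x <= 1) ->
  forall j, `|x 0 j| <= n.+1%:R * n%:R.
Proof.
move=> xS j; rewrite -[in n.+1%:R](card_ord n.+1).
exact: (contact_bounded (fun=> weight_gt0) simplex_normal_unit
  weighted_balanced weighted_identity).
Qed.


(** The components along [ones] of a hidden point and of a hiding normal are
opposite: their product is negative, and outweighs an overlap
[#|J :&: J'|] of up to [n / 256] elements.  The factor [8] keeps the normals in
the unit ball; the factor [64] keeps the products of the points with the simplex
normals below [1 / sqrt n]. *)
Definition indicator J : 'rV[R]_n := \row_l (l \in J)%:R.
Definition hidden_point J : 'rV[R]_n :=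
  (64 / s) *: ((1 / 16) *: ones - indicator J).
Definition hiding_normal J : 'rV[R]_n :=
  - (8 / s) *: ((1 / 16) *: ones + indicator J).

Lemma dot_ones_indicator J : dot ones (indicator J) = #|J|%:R.
Proof.
rewrite dot_ones -sum1_card natr_sum [RHS]big_mkcond /=.
by apply: eq_bigr => l _; rewrite mxE; case: (l \in J).
Qed.

Lemma dot_indicator J J' : dot (indicator J) (indicator J') = #|J :&: J'|%:R.
Proof.
rewrite -sum1_card natr_sum [RHS]big_mkcond /=.
by apply: eq_bigr => l _; rewrite !mxE inE; do 2 case: (l \in _); rewrite ?mulr1 ?mulr0.
Qed.

Lemma dot_hiding_hidden J J' : #|J| = #|J'| ->
  dot (hiding_normal J) (hidden_point J') =
  512 * (#|J :&: J'|%:R / n%:R - 1 / 256).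
Proof.
move=> JJ'; rewrite dotZl dotZr dotBr !dotDl !dotZl !dotZr dot_ones_ones.
rewrite (dotC _ ones) !dot_ones_indicator dot_indicator JJ' -s_sqr.
by field; rewrite gt_eqF.
Qed.

Lemma hiding_normal_ball J : (128 * #|J| <= n)%N ->
  dot (hiding_normal J) (hiding_normal J) <= 1.
Proof.
rewrite -(ler_nat R) natrM => Jn.
rewrite dotZl dotZr dotDr !dotDl !dotZl !dotZr dot_ones_ones.
rewrite (dotC _ ones) !dot_ones_indicator dot_indicator finset.setIid.
rewrite [leLHS](_ : _ = 64 * (9 / 8 * #|J|%:R + n%:R / 256) / n%:R); last first.
  by rewrite -s_sqr; field; rewrite gt_eqF.
by rewrite ler_pdivrMr // mul1r; move: Jn nR; lra.
Qed.

Lemma dot_simplex_hidden i J : (1024 <= n)%N -> (128 * #|J| <= n)%N ->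
  dot (simplex_normal i) (hidden_point J) <= s^-1.
Proof.
move=> n1024; rewrite -(ler_nat R) natrM => Jn.
have si0 : 0 < s^-1 by rewrite invr_gt0.
have s32 : 32 <= s.
  have n1024R : 1024%:R <= n%:R :> R by rewrite ler_nat.
  rewrite -ler_sqr ?nnegrE ?(ltW s_gt0) // s_sqr; apply: le_trans n1024R; lra.
have [l ->|->] := unliftP ord0 i; last first.
  rewrite dot_normal0 dotZr dotBr dotZr dot_ones_ones dot_ones_indicator.
  apply: (@le_trans _ _ 0); last exact: ltW.
  rewrite mulNr oppr_le0; apply: (mulr_ge0 (ltW si0)).
  apply: mulr_ge0; first by rewrite divr_ge0 // ltW.
  by move: Jn nR; lra.
rewrite dot_normal_lift dotZr dotBr dotZr dot_ones_ones dot_ones_indicator !mxE.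
have a0 : 0 <= alpha by exact: sqrtr_ge0.
have a32 : alpha <= 3 / 2.
  rewrite -ler_sqr ?nnegrE ?divr_ge0 // alpha_sqr.
  have : n%:R^-1 <= 1 :> R by rewrite invf_le1 // ler1n.
  lra.
set e : R := (l \in J)%:R; have e0 : 0 <= e by [].
set m : R := #|J|%:R in Jn *; have m0 : 0 <= m by [].
have mn : m / n%:R <= 1 / 128 by rewrite ler_pdivrMr //; move: Jn; lra.
have mn0 : 0 <= m / n%:R by rewrite divr_ge0 // ltW.
(* Both [m / n] and [s^-1] are small; the term [- alpha * e] only helps. *)
have -> : alpha * (64 / s * (1 / 16 * 1 - e)) + beta * (64 / s * (1 / 16 * n%:R - m)) =
   s^-1 * (64 * (alpha * (m / n%:R) - alpha * e + s^-1 * (1 / 16 - m / n%:R))).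
  by rewrite /beta; field; rewrite !gt_eqF.
rewrite ger_pMr //.
have s32' : s^-1 <= 1 / 32 by rewrite -[s^-1]mul1r ler_pdivrMr //; lra.
have := mulr_ge0 a0 e0.
have := ler_wpM2l a0 mn.
have : s^-1 * (1 / 16 - m / n%:R) <= 1 / 32 * (1 / 16) by apply: ler_pM; lra.
lra.
Qed.

End Simplex.

(** * The body and the facet count *)

(** The graphs of the words of a code of length [2 * k] over [128] letters, as
subsets of [256 * k] coordinates: two graphs overlap where the words agree.
It has at least [32 ^ k] words as [128 ^ (2 * k) = 32 ^ k * 4 ^ k * 128 ^ k]. *)
Lemma subsets_with_small_overlaps (n k : nat) : (0 < k)%N -> (256 * k <= n)%N ->
  exists (X : finType) (J : X -> {set 'I_n}),
    [/\ (32 ^ k <= #|X|)%N, forall s, #|J s| = (2 * k)%N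
      & forall s t, s != t -> (#|J s :&: J t| <= k)%N].
Proof.
move=> k0 kn; pose I := 'I_(2 * k); pose A := 'I_128.
have kI : (k < #|I|)%N by rewrite card_ord; lia.
have [F [Fsep Fcard]] := @code_exists I A k kI.
have cardIA : (#|{: I * A}| <= n)%N by rewrite card_prod !card_ord; lia.
pose e (p : I * A) : 'I_n := widen_ord cardIA (enum_rank p).
have e_inj : injective e.
  by move=> p q /(congr1 val)/= /val_inj /enum_rank_inj.
pose J (f : {ffun I -> A}) : {set 'I_n} := [set e (i, f i) | i : I]%SET.
have Jinj f : injective (fun i => e (i, f i)) by move=> i j /e_inj[].
exists {f : {ffun I -> A} | f \in F}, (fun s => J (val s)); split.
- rewrite card_sig -[#|_|]/(#|F|).
  move: Fcard; rewrite !card_ord => Fcard.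
  rewrite -(leq_pmul2r (_ : 0 < 2 ^ (2 * k) * 128 ^ (2 * k - k.+1))%N); last first.
    by rewrite muln_gt0 !expn_gt0.
  apply: leq_trans Fcard.
  have -> : (2 * k - k.+1 = k.-1)%N by lia.
  have -> : (128 ^ (2 * k) = 32 ^ k * 4 ^ k * 128 ^ k)%N.
    by rewrite -expnMn mul2n -addnn expnD.
  have -> : (2 ^ (2 * k) = 4 ^ k)%N by rewrite expnM.
  by rewrite mulnA leq_mul2l leq_pexp2l ?leq_pred ?orbT.
- by move=> s; rewrite card_imset // card_ord.
- move=> s t st; apply: leq_trans (Fsep _ _ (valP s) (valP t) _); last first.
    by rewrite (inj_eq val_inj).
  rewrite -(card_imset (mem (agreement (val s) (val t))) (Jinj (val s))).
  apply/subset_leq_card/fintype.subsetP => l; rewrite !inE.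
  move=> /andP[/imsetP[i _ ->] /imsetP[j _ /e_inj[<- fij]]].
  by apply/imsetP; exists i; rewrite // !inE fij.
Qed.

(** John's position depends only on the simplex: the hiding normals are in the
unit ball, so the cuts that they make do not reach the ball. *)
Section HardBody.
Context {R : realType} {n : nat}.
Variables (X : finType) (J : X -> {set 'I_n}).

Definition hard_normals (t : 'I_n.+1 + X) : 'rV[R]_n :=
  match t with inl i => simplex_normal i | inr s => hiding_normal (J s) end.

Definition hard_body : set 'rV[R]_n := polar_of hard_normals.

Hypothesis n_gt0 : (0 < n)%N.
Hypothesis Jn : forall s, (128 * #|J s| <= n)%N.

Lemma unit_ball_sub_hard_body : unit_ball `<=` hard_body.
Proof.
apply: unit_ball_sub_polar => -[i|s] /=; first by rewrite simplex_normal_unit.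
exact: hiding_normal_ball.
Qed.

Lemma hard_body_convex_body : convex_body hard_body.
Proof.
split; first exact: polar_convex.
  apply: polar_compact => x xK; apply: simplex_bounded => // i.
  exact: (xK (inl i)).
exact: interior_of_unit_ball unit_ball_sub_hard_body.
Qed.

Lemma hard_body_john : john_position hard_body.
Proof.
apply: simplex_john => //; first exact: unit_ball_sub_hard_body.
by move=> x xK i; exact: (xK (inl i)).
Qed.

End HardBody.

(** With [#|J s| = 2 * k] close to [n / 128], the threshold [n / 256] of
[dot_hiding_hidden] lies between the overlaps, at most [k], and [#|J s|]. *)
Lemma facets_lower_bound (R : realType) (n k : nat) (X : finType)
    (J : X -> {set 'I_n}) (P : set 'rV[R]_n) (m : nat) :
  (3 <= k)%N -> (256 * k <= n < 256 * k.+1)%N -> (1024 <= n)%N ->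
  (forall s, #|J s| = (2 * k)%N) ->
  (forall s t, s != t -> (#|J s :&: J t| <= k)%N) ->
  polytope P -> facets P #= `I_m ->
  hard_body J `<=` P -> P `<=` dilate (Num.sqrt n%:R) (hard_body J) ->
  #|X|%:R <= m%:R * (2 * Num.sqrt n%:R) :> R.
Proof.
move=> k3 /andP[kn nk] n1024 Jcard Jsep Ppoly Pm KP PK.
have n0 : (0 < n)%N by lia.
have nR : 0 < n%:R :> R by rewrite ltr0n.
have s0 : 0 < Num.sqrt n%:R :> R by rewrite sqrtr_gt0.
have Jn s : (128 * #|J s| <= n)%N by rewrite Jcard; lia.
have BP : unit_ball `<=` P.
  by apply: subset_trans KP; exact: unit_ball_sub_hard_body.
have [q [a [qm Pa]]] := facet_description Ppoly BP Pm.
have PE : P = polar_of a by apply/seteqP; split => x /Pa.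
have knR : 256 * k%:R <= n%:R :> R by rewrite -natrM ler_nat.
have nkR : n%:R < 256 * (k%:R + 1) :> R by rewrite natr1 -natrM ltr_nat.
have k3R : 3 <= k%:R :> R by rewrite ler_nat.
apply: (@le_trans _ _ (q%:R * (2 * Num.sqrt n%:R))); last first.
  by rewrite ler_wpM2r ?ler_nat // mulr_ge0 // ltW.
rewrite PE in KP PK.
apply: (@hidden_points_bound _ _ (Num.sqrt n%:R) 'I_n.+1 X simplex_normal
  (fun s => hiding_normal (J s)) (fun s => hidden_point (J s)) q a) => //.
- by move=> i s; exact: dot_simplex_hidden.
- move=> s; rewrite dot_hiding_hidden // finset.setIid Jcard natrM.
  have : 3 / 512 < 2 * k%:R / n%:R :> R by rewrite ltr_pdivlMr //; lra.
  lra.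
- move=> s; rewrite dot_hiding_hidden // finset.setIid Jcard natrM.
  have : 2 * k%:R / n%:R <= 1 / 128 :> R by rewrite ler_pdivrMr //; lra.
  lra.
- move=> s t st; rewrite (dot_hiding_hidden n0); last by rewrite !Jcard.
  have : #|J s :&: J t|%:R / n%:R <= 1 / 256 :> R.
    have : #|J s :&: J t|%:R <= k%:R :> R by rewrite ler_nat Jsep.
    by rewrite ler_pdivrMr //; lra.
  lra.
Qed.

Lemma exp_beats_linear (k : nat) : (4 <= k)%N -> (64 * k.+1 <= 16 ^ k)%N.
Proof.
elim: k => // k IH; rewrite leq_eqVlt => /orP[/eqP<- //|/IH h].
by rewrite expnS; lia.
Qed.

Theorem corollary1p4 (R : realType) :
  exists2 c : R, 0 < c &
    exists N : nat, forall n : nat, (N <= n)%N ->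
      exists K : set 'rV[R]_n,
        [/\ convex_body K,
            john_position K
          & ~ exists P : set 'rV[R]_n,
              [/\ polytope P,
                  exists2 m : nat,
                    facets P #= `I_m & m%:R < expR (c * n%:R),
                  K `<=` P
                & P `<=` dilate (Num.sqrt n%:R) K]].
Proof.
(* With [k = n %/ 256], fewer than [2 ^ k.+1] facets deal with fewer than
   [2 ^ k.+1 * (2 * 16 * k.+1)] hidden points, but there are [32 ^ k]. *)
have ln2 : 0 < ln 2 :> R by rewrite ln_gt0 // ltr1n.
exists (ln 2 / 256); first by rewrite divr_gt0 ?ltr0n.
exists 1024%N => n n1024; pose k := (n %/ 256)%N.
have kn : (256 * k <= n < 256 * k.+1)%N.
  by rewrite /k; lia.
have k4 : (4 <= k)%N by rewrite /k; lia.
have n0 : (0 < n)%N by lia.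
have [||X [J [XX Jcard Jsep]]] := @subsets_with_small_overlaps n k.
- by lia.
- by case/andP: kn.
have Jn s : (128 * #|J s| <= n)%N by rewrite Jcard; lia.
exists (hard_body J); split.
- exact: hard_body_convex_body.
- exact: hard_body_john.
move=> [P [Ppoly [m Pm mlt] KP PK]].
have := @facets_lower_bound R n k X J P m (ltnW k4) kn n1024 Jcard Jsep Ppoly Pm KP PK.
apply/negP; rewrite -ltNge.
have s0 : 0 < Num.sqrt n%:R :> R by rewrite sqrtr_gt0 ltr0n.
have nk : n%:R <= 256 * k.+1%:R :> R by rewrite -natrM ler_nat ltnW //; case/andP: kn.
have sk : Num.sqrt n%:R <= 16 * k.+1%:R :> R.
  rewrite -ler_sqr ?nnegrE ?(ltW s0) ?mulr_ge0 // sqr_sqrtr ?ler0n //.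
  apply: le_trans nk _; rewrite exprMn -!natrX -!natrM ler_nat.
  by rewrite expnS expn1; nia.
have expk : expR (ln 2 / 256 * n%:R) <= 2 ^+ k.+1 :> R.
  rewrite -[in leRHS](lnK (x := 2)) ?posrE // -expRM_natr ler_expR.
  by rewrite mulrAC ler_pdivrMr ?ltr0n // -mulrA ler_pM2l // mulrC.
apply: (@lt_le_trans _ _ (2 ^+ k.+1 * (2 * (16 * k.+1%:R)))).
  apply: (@lt_le_trans _ _ (2 ^+ k.+1 * (2 * Num.sqrt n%:R))).
    by rewrite ltr_pM2r ?mulr_gt0 //; exact: lt_le_trans expk.
  by rewrite ler_pM2l ?exprn_gt0 // ler_pM2l.
apply: le_trans (_ : (32 ^ k)%:R <= _); last by rewrite ler_nat.
rewrite -natrX -!natrM ler_nat.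
have -> : (32 ^ k = 2 ^ k * 16 ^ k)%N by rewrite -expnMn.
have := exp_beats_linear k4.
rewrite expnS => h.
rewrite (_ : 2 * 2 ^ k * (2 * (16 * k.+1)) = 2 ^ k * (64 * k.+1))%N; last by lia.
by rewrite leq_mul2l h orbT.
Qed.
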